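(* Let $\mathbb{K}$ be an algebraically closed field of characteristic zero. Up to isomorphism (as quadratic Lie algebras, i.e. isometric isomorphism), every indecomposable quadratic nilpotent Lie algebra over $\mathbb{K}$ which is of type $1$, or of type $2$ and nilpotent index $\leq5$, or of type $3$ and nilpotent index $\leq3$, is isomorphic to one of the following quadratic Lie algebras (all forms are symmetric; products not determined by the listed ones through antisymmetry are zero): (i) The $1$-dimensional abelian Lie algebra $(\mathfrak{n}_{1,1},\phi)$ with basis $\{a_1\}$ and $\phi(a_1,a_1)=1$. (ii) The $5$-dimensional free nilpotent Lie algebra $(\mathfrak{n}_{2,3},\varphi)$ with basis $\{a_i\}_{i=1}^5$ and products $[a_2,a_1]=a_3$, $[a_3,a_1]=a_4$, $[a_3,a_2]=a_5$, where $\varphi(a_i,a_j)=(-1)^{i-1}$ for $i\leq j$, $i+j=6$, and $\varphi(a_i,a_j)=0$ for all other $i\le j$. (iii) The $7$-dimensional Lie algebra $(\mathfrak{n}_{2,5}^1,\varphi_1)$ with basis $\{a_i\}_{i=1}^7$ and products $[a_2,a_1]=a_3$, $[a_3,a_1]=a_4$, $[a_4,a_1]=a_5$, $[a_5,a_1]=a_6$, $[a_5,a_2]=a_7$, $[a_3,a_4]=a_7$, where $\varphi_1(a_i,a_j)=(-1)^i$ for $i\leq j$, $i+j=8$, and $\varphi_1(a_i,a_j)=0$ for all other $i\le j$. (iv) The $8$-dimensional Lie algebra $(\mathfrak{n}_{2,5}^2,\varphi_2)$ with basis $\{a_i\}_{i=1}^8$ and products $[a_2,a_1]=a_3$, $[a_3,a_1]=a_4$,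 $[a_3,a_2]=a_5$, $[a_4,a_1]=a_6$, $[a_6,a_1]=a_7$, $[a_6,a_2]=a_8$, $[a_2,a_5]=-a_6$, $[a_4,a_3]=-a_8$, $[a_5,a_3]=a_7$, where $\varphi_2(a_i,a_j)=(-1)^i$ for $1\leq i\leq3$, $i+j=9$, $\varphi_2(a_4,a_4)=\varphi_2(a_5,a_5)=1$, and $\varphi_2(a_i,a_j)=0$ for all other $i\le j$. (v) The $6$-dimensional free nilpotent Lie algebra $(\mathfrak{n}_{3,2},\psi)$ with basis $\{a_i\}_{i=1}^6$ and products $[a_2,a_1]=a_4$, $[a_3,a_1]=a_5$, $[a_3,a_2]=a_6$, where $\psi(a_i,a_j)=(-1)^{i-1}$ for $i\leq j$, $i+j=7$, and $\psi(a_i,a_j)=0$ for all other $i\le j$. (vi) The $8$-dimensional Lie algebra $(\mathfrak{n}_{3,3}^1,\psi_1)$ with basis $\{a_i\}_{i=1}^8$ and products $[a_2,a_1]=a_4$, $[a_3,a_1]=a_5$, $[a_4,a_1]=a_6$, $[a_4,a_2]=a_7$, $[a_5,a_1]=a_8$, $[a_5,a_3]=a_7$, where $\psi_1(a_4,a_4)=\psi_1(a_5,a_5)=1$, $\psi_1(a_1,a_7)=1=-\psi_1(a_2,a_6)=-\psi_1(a_3,a_8)$, and $\psi_1(a_i,a_j)=0$ for all other $i\le j$. (vii) The $9$-dimensional Lie algebra $(\mathfrak{n}_{3,3}^2,\psi_2)$ with basis $\{a_i\}_{i=1}^9$ and products $[a_2,a_1]=a_4$, $[a_3,a_1]=a_5$,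 $[a_3,a_2]=a_6$, $[a_4,a_1]=a_7$, $[a_4,a_2]=a_8$, $[a_5,a_1]=a_9$, $[a_5,a_3]=a_8$, $[a_6,a_3]=-a_7$, $[a_6,a_2]=a_9$, where $\psi_2(a_4,a_4)=\psi_2(a_5,a_5)=\psi_2(a_6,a_6)=1$, $\psi_2(a_1,a_8)=1=-\psi_2(a_2,a_7)=-\psi_2(a_3,a_9)$, and $\psi_2(a_i,a_j)=0$ for all other $i\le j$. Any nonabelian nilpotent quadratic Lie algebra of type $\leq2$ is indecomposable. The nonabelian decomposable nilpotent quadratic Lie algebras of type $3$ and nilpotent index $\leq3$ are the orthogonal sums $(\mathfrak{n}_{1,1},\phi)\oplus L$ where $L$ is a quadratic Lie algebra as in item (ii), (iii) or (iv).
   Context: For a Lie algebra $\mathfrak{n}$ put $\mathfrak{n}^1=\mathfrak{n}$, $\mathfrak{n}^i=[\mathfrak{n}^{i-1},\mathfrak{n}]$. A nilpotent $\mathfrak{n}$ has nilpotent index (nilindex) $t$ if $\mathfrak{n}^{t+1}=0$, $\mathfrak{n}^t\ne0$; its type is $\dim\mathfrak{n}/\mathfrak{n}^2$. A quadratic Lie algebra is a pair $(\mathfrak{n},B)$ with $B$ a nondegenerate symmetric bilinear form that is invariant: $B([x,y],z)=B(x,[y,z])$. Isometric isomorphisms are Lie algebra isomorphisms preserving the forms. A quadratic Lie algebra is decomposable if it contains a proper nonzero ideal on which the form is nondegenerate; otherwise indecomposable.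
   Formalization: In the last sentence, the sums with L as in (iii) or (iv) have nilpotent index 5, so the converse is proved as: all the sums are nonabelian, nilpotent, decomposable, of type 3, and nilpotent index ≤3 is asserted only for L as in (ii). *)

(* Defs.v *)
From HB Require Import structures.
From mathcomp Require Import all_boot all_order all_algebra.
From mathcomp Require Import ring.

Set Implicit Arguments.
Unset Strict Implicit.
Unset Printing Implicit Defensive.

Import GRing.Theory.
Local Open Scope ring_scope.

(* A finite-dimensional Lie algebra.  Finite-dimensionality costs nothing: a
   nilpotent Lie algebra n with n / n^2 finite-dimensional is itself
   finite-dimensional. *)
Record lieAlgebra (K : fieldType) := LieAlgebra {
  lie_space :> vectType K;
  lie_bracket : {bilinear lie_space -> lie_space -> lie_space};
  lie_alternating : forall x, lie_bracket x x = 0;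
  lie_jacobi : forall x y z,
    lie_bracket x (lie_bracket y z) + lie_bracket y (lie_bracket z x)
      + lie_bracket z (lie_bracket x y) = 0
}.

Declare Scope lie_scope.
Notation "[ 'lie' x , y ]" := (lie_bracket _ x y)
  (at level 0, x, y at level 99, format "[ 'lie'  x ,  y ]") : lie_scope.
Local Open Scope lie_scope.

Record quadLie (K : fieldType) := QuadLie {
  quad_lie :> lieAlgebra K;
  quad_form : {symmetric quad_lie};
  quad_invariant : forall x y z : quad_lie,
    quad_form [lie x, y] z = quad_form x [lie y, z];
  quad_nondegenerate : nondegenerate quad_form
}.

Section LieNotions.
Variables (K : fieldType) (L : lieAlgebra K).
Implicit Types U V W : {vspace L}.

(* [U, V], the span of the brackets [x, y] with x in U and y in V (lie_prodvP);
   generators suffice by bilinearity, as for prodv in falgebra. *)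
Definition lie_prodv U V : {vspace L} :=
  <<[seq [lie x, y] | x <- vbasis U, y <- vbasis V]>>%VS.

Lemma lie_prodvP U V W :
  reflect (forall x y, x \in U -> y \in V -> [lie x, y] \in W)
          (lie_prodv U V <= W)%VS.
Proof.
apply: (iffP span_subvP) => [sUVW x y xU yV | sUVW _ /allpairsP[[x y] [/= xU yV ->]]].
  rewrite (coord_vbasis xU) (coord_vbasis yV) linear_sumlz.
  apply: memv_suml => i _; rewrite linear_sumr; apply: memv_suml => j _.
  rewrite linearZl_LR linearZr_LR !memvZ // sUVW //; apply/allpairsP.
  by exists ((vbasis U)`_i, (vbasis V)`_j); rewrite !mem_nth ?size_tuple.
by apply: sUVW; apply: vbasis_mem.
Qed.

(* The ideal n^i, for i >= 1; the value at i = 0 is junk (also n). *)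
Definition lower_central (i : nat) : {vspace L} :=
  iter i.-1 (fun U => lie_prodv U fullv) fullv.

Definition lie_nilpotent : Prop := exists t, lower_central t.+1 = 0%VS.

Definition nilindex (t : nat) : Prop :=
  lower_central t.+1 = 0%VS /\ lower_central t <> 0%VS.

Definition nilindex_le (m : nat) : Prop := exists2 t, (t <= m)%N & nilindex t.

(* dim (n / n^2) *)
Definition lie_type : nat := (\dim {:L} - \dim (lower_central 2))%N.

Definition lie_abelian : Prop := forall x y : L, [lie x, y] = 0.

Definition lie_ideal U : Prop := forall x y, x \in U -> [lie x, y] \in U.

End LieNotions.

(* The restriction of B to U is nondegenerate. *)
Definition nondegenerate_on (K : fieldType) (V : vectType K)
    (B : {symmetric V}) (U : {vspace V}) : Prop :=
  (U :&: orthov B U)%VS = 0%VS.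

Definition decomposable (K : fieldType) (L : quadLie K) : Prop :=
  exists U : {vspace L},
    [/\ lie_ideal U, U <> 0%VS, U <> fullv & nondegenerate_on (quad_form L) U].

Definition indecomposable (K : fieldType) (L : quadLie K) : Prop :=
  ~ decomposable L.

Definition isometric (K : fieldType) (L M : quadLie K) : Prop :=
  exists f : {linear L -> M},
    [/\ bijective f,
        forall x y, f [lie x, y] = [lie f x, f y]
      & forall x y, quad_form M (f x) (f y) = quad_form L x y].

Lemma nondegenerateP (K : fieldType) (V : vectType K) (B : {symmetric V}) :
  (forall x, (forall y, B x y = 0) -> x = 0) -> nondegenerate B.
Proof.
move=> nd; rewrite /nondegenerate -subv0; apply/subvP => x /mem_orthovP xV.
by rewrite memv0; apply/eqP/nd => y; apply: xV; rewrite memvf.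
Qed.

Lemma nondegenerate_eq0 (K : fieldType) (V : vectType K) (B : {symmetric V}) :
  nondegenerate B -> forall x, (forall y, B x y = 0) -> x = 0.
Proof.
move=> /eqP nd x xV; apply/eqP; rewrite -memv0 -nd.
by apply/mem_orthovP => y _; apply: xV.
Qed.

Section OrthogonalSum.
Variables (K : fieldType) (L M : quadLie K).

Definition osum_bracket (x y : L * M) : L * M :=
  ([lie x.1, y.1], [lie x.2, y.2]).

Definition osum_form (x y : L * M) : K :=
  quad_form L x.1 y.1 + quad_form M x.2 y.2.

Lemma osum_bracket_bilinear : bilinear_for *:%R *:%R osum_bracket.
Proof.
split=> [z a x y | z a x y]; rewrite /osum_bracket /=;
  by rewrite ?linearPl ?linearPr.
Qed.

HB.instance Definition _ :=
  bilinear_isBilinear.Build K _ _ _ _ _ osum_bracket osum_bracket_bilinear.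

Lemma osum_form_bilinear :
  bilinear_for (GRing.Scale.Law.clone K K ( *%R ) _)
    (GRing.Scale.Law.clone K K (idfun \; *%R) _) osum_form.
Proof.
split=> [z a x y | z a x y]; rewrite /osum_form /= ?linearPl ?linearPr /=;
  ring.
Qed.

HB.instance Definition _ :=
  bilinear_isBilinear.Build K _ _ _ _ _ osum_form osum_form_bilinear.

Lemma osum_form_symmetric x y :
  osum_form x y = (-1) ^+ false * idfun (osum_form y x).
Proof.
rewrite /osum_form expr0 mul1r /= (hermC (quad_form L)) (hermC (quad_form M)).
by rewrite /= !expr0 !mul1r.
Qed.

HB.instance Definition _ :=
  @isHermitianSesquilinear.Build K (L * M)%type false idfun osum_form
    osum_form_symmetric.

Lemma osum_alternating x : osum_bracket x x = 0.
Proof. by rewrite /osum_bracket !lie_alternating. Qed.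

Lemma osum_jacobi x y z :
  osum_bracket x (osum_bracket y z) + osum_bracket y (osum_bracket z x)
    + osum_bracket z (osum_bracket x y) = 0.
Proof. by congr pair; apply: lie_jacobi. Qed.

Definition osum_lie : lieAlgebra K :=
  @LieAlgebra K (L * M)%type osum_bracket osum_alternating osum_jacobi.

Lemma osum_invariant (x y z : osum_lie) :
  osum_form [lie x, y] z = osum_form x [lie y, z].
Proof. by congr (_ + _); apply: quad_invariant. Qed.

Lemma osum_nondegenerate : nondegenerate (osum_form : {symmetric (L * M)%type}).
Proof.
apply: nondegenerateP => -[x1 x2] x0; congr pair.
  apply: (nondegenerate_eq0 (quad_nondegenerate L)) => y.
  by have := x0 (y, 0); rewrite /= /osum_form /= linear0r addr0.
apply: (nondegenerate_eq0 (quad_nondegenerate M)) => y.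
by have := x0 (0, y); rewrite /= /osum_form /= linear0r add0r.
Qed.

Definition osum : quadLie K :=
  @QuadLie K osum_lie osum_form osum_invariant osum_nondegenerate.

End OrthogonalSum.

(* Quadratic Lie algebras given by tables, on K^n with its standard basis
   a_1, ..., a_n.  A table of products is a sequence of tuples (i, j, c, k)
   standing for [a_i, a_j] = c a_k; each one also determines [a_j, a_i], and
   the products that are not determined by the table are zero.  A form is given
   by its values f i j on (a_i, a_j) for i <= j. *)
Section Tables.
Variables (K : fieldType) (m : nat).
Local Notation n := m.+1.
Implicit Types x y z : 'rV[K]_n.

Definition crd x (i : nat) : K := x 0 (inord i.-1).

Variable T : seq (nat * nat * int * nat).

Definition tbracket x y : 'rV[K]_n :=
  \row_(l < n) \sum_(t <- T | t.2 == l.+1)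
    let: (i, j, c, _) := t in
    c%:~R * (crd x i * crd y j - crd x j * crd y i).

Variable f : nat -> nat -> int.

Definition tform x y : K :=
  \sum_(i < n) \sum_(j < n)
    (f (minn i j).+1 (maxn i j).+1)%:~R * (x 0 i * y 0 j).

Lemma crdP a x y i : crd (a *: x + y) i = a * crd x i + crd y i.
Proof. by rewrite /crd !mxE. Qed.

Lemma tbracket_bilinear : bilinear_for *:%R *:%R tbracket.
Proof.
split=> [z a x y | z a x y]; apply/rowP=> l; rewrite !mxE mulr_sumr -big_split /=;
  by apply: eq_bigr => -[[[i j] c] k] _; rewrite !crdP; ring.
Qed.

HB.instance Definition _ :=
  bilinear_isBilinear.Build K _ _ _ _ _ tbracket tbracket_bilinear.

Lemma tform_bilinear :
  bilinear_for (GRing.Scale.Law.clone K K ( *%R ) _)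
    (GRing.Scale.Law.clone K K (idfun \; *%R) _) tform.
Proof.
split=> [z a x y | z a x y] /=; rewrite /tform mulr_sumr -big_split /=;
  apply: eq_bigr => i _; rewrite mulr_sumr -big_split /=;
  by apply: eq_bigr => j _; rewrite !mxE; ring.
Qed.

HB.instance Definition _ :=
  bilinear_isBilinear.Build K _ _ _ _ _ tform tform_bilinear.

Lemma tform_symmetric x y : tform x y = (-1) ^+ false * idfun (tform y x).
Proof.
rewrite expr0 mul1r /= /tform exchange_big /=.
apply: eq_bigr => i _; apply: eq_bigr => j _.
by rewrite minnC maxnC [x 0 _ * _]mulrC.
Qed.

HB.instance Definition _ :=
  @isHermitianSesquilinear.Build K 'rV[K]_n false idfun tform tform_symmetric.

Lemma tbracket_alternating x : tbracket x x = 0.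
Proof.
apply/rowP=> l; rewrite !mxE big1 // => -[[[i j] c] k] _.
by rewrite [crd x j * _]mulrC subrr mulr0.
Qed.

Definition tjacobi := forall x y z,
  tbracket x (tbracket y z) + tbracket y (tbracket z x)
    + tbracket z (tbracket x y) = 0.
Definition tinvariant := forall x y z,
  tform (tbracket x y) z = tform x (tbracket y z).
Definition tnondegenerate := forall x, (forall y, tform x y = 0) -> x = 0.

Variables (TJ : tjacobi) (TI : tinvariant) (TN : tnondegenerate).

Definition tlie : lieAlgebra K :=
  @LieAlgebra K 'rV[K]_n tbracket tbracket_alternating TJ.

Definition tquad : quadLie K :=
  @QuadLie K tlie tform TI (@nondegenerateP K 'rV[K]_n tform TN).

(* The nonzero values of the form on pairs of basis vectors. *)
Definition fsupp : seq (nat * nat * int) :=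
  [seq t <- [seq (p.1, p.2, f (minn p.1 p.2) (maxn p.1 p.2))
            | p <- [seq (i, j) | i <- iota 1 n, j <- iota 1 n]]
  | t.2 != 0].

Lemma fsupp_bound t :
  t \in fsupp -> (0 < t.1.1 <= n)%N && (0 < t.1.2 <= n)%N.
Proof.
rewrite mem_filter => /andP[_ /mapP[_ /allpairsP[[a b] [a_n b_n ->]] ->]].
by move: a_n b_n; rewrite !mem_iota !add1n !ltnS => a_n b_n; apply/andP.
Qed.

Lemma iota1 : iota 1 n = map S (index_iota 0 n).
Proof. by rewrite /index_iota subn0 -(addn0 1%N) iotaDl. Qed.

Lemma tformE x y : tform x y =
  \sum_(t <- fsupp) t.2%:~R * (crd x t.1.1 * crd y t.1.2).
Proof.
rewrite big_filter big_mkcond big_map big_allpairs_dep.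
rewrite iota1 big_map big_mkord; apply: eq_bigr => i _.
rewrite big_map big_mkord; apply: eq_bigr => j _.
rewrite -minnSS -maxnSS /crd /= !inord_val.
by case: eqP => //= ->; rewrite mul0r.
Qed.

(* A form pairing each basis vector with exactly one basis vector, with
   coefficient 1 or -1, is nondegenerate. *)
Lemma tform_nondegenerate :
  all (fun i => if [seq t <- fsupp | t.1.1 == i] is [:: t]
                then [&& t.2 * t.2 == 1, (0 < t.1.2 <= n)%N
                       & [seq u <- fsupp | u.1.2 == t.1.2] == [:: t]]
                else false) (iota 1 n) ->
  forall x, (forall y, tform x y = 0) -> x = 0.
Proof.
move=> /allP f1 x x0; apply/rowP=> i; rewrite mxE.
have /f1 : i.+1 \in iota 1 n by rewrite mem_iota andTb add1n ltnS.
case Ei: [seq t <- _ | _] => [|[[i' q] c] [|? ?]] //= /and3P[cc q_n Eq].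
have /andP[/eqP /= Di' _] : ((i', q, c).1.1 == i.+1) && ((i', q, c) \in fsupp).
  by rewrite -(mem_filter (fun t => t.1.1 == i.+1)) Ei mem_head.
have := x0 (delta_mx 0 (inord q.-1)); rewrite tformE.
have crdq u : u \in fsupp ->
    crd (delta_mx 0 (inord q.-1) : 'rV[K]_n) u.1.2 = (u.1.2 == q)%:R.
  rewrite mem_filter => /andP[_ /mapP[_ /allpairsP[[a b] [_ b_n ->]] ->]].
  rewrite /crd mxE eqxx /=; congr _%:R; congr nat_of_bool.
  move: b_n; rewrite mem_iota add1n ltnS /=.
  case: b => // b; rewrite andTb => b_n; case: q q_n {Ei Eq Di'} => // q.
  by move=> q_n; rewrite -val_eqE /= !inordK.
rewrite (eq_big_seq (fun t => if t.1.2 == q then t.2%:~R * crd x t.1.1 else 0)).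
  rewrite -big_mkcond -big_filter (eqP Eq) big_seq1 /= Di'.
  rewrite /crd /= inord_val => cx.
  have: (c * c)%:~R * x 0 i = 0 by rewrite intrM -mulrA cx mulr0.
  by rewrite (eqP cc) mul1r.
by move=> t /crdq /= ->; case: eqP => _; rewrite ?mulr1 ?mulr0.
Qed.

Lemma crd_eqP x y :
  (forall l, l \in iota 1 n -> crd x l = crd y l) -> x = y.
Proof.
move=> xy; apply/rowP=> l.
have /xy : l.+1 \in iota 1 n by rewrite mem_iota andTb add1n ltnS.
by rewrite /crd /= inord_val.
Qed.

Lemma crdD x y l : crd (x + y) l = crd x l + crd y l.
Proof. by rewrite /crd mxE. Qed.

Lemma crd0 l : crd (0 : 'rV[K]_n) l = 0.
Proof. by rewrite /crd mxE. Qed.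

(* The bracket and the form on coordinates, in computable form. *)
Definition cbracket (X Y : nat -> K) (l : nat) : K :=
  foldr (fun t s => let: (i, j, c, k) := t in
    if k == l then c%:~R * (X i * Y j - X j * Y i) + s else s) 0 T.

Definition cform (S : seq (nat * nat * int)) (X Y : nat -> K) : K :=
  foldr (fun t s => let: (i, j, c) := t in c%:~R * (X i * Y j) + s) 0 S.

Lemma crd_tbracket x y l : (0 < l <= n)%N ->
  crd (tbracket x y) l = cbracket (crd x) (crd y) l.
Proof.
case: l => // l; rewrite ltnS => lm; rewrite /crd !mxE /= inordK //.
by rewrite /cbracket; elim: T => [|[[[i j] c] k] s IHs];
  rewrite ?big_nil // big_cons IHs.
Qed.

Lemma eq_cbracket X X' Y Y' :
  all (fun t => (0 < t.1.1.1 <= n)%N && (0 < t.1.1.2 <= n)%N) T ->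
  {in [pred i | 0 < i <= n], X =1 X'}%N ->
  {in [pred i | 0 < i <= n], Y =1 Y'}%N ->
  cbracket X Y =1 cbracket X' Y'.
Proof.
rewrite /cbracket => + eX eY l; elim: T => //= -[[[i j] c] k] s IHs /=.
by case/andP=> /andP[i_n j_n] /IHs->; rewrite !eX // !eY.
Qed.

Lemma tform_cform x y : tform x y = cform fsupp (crd x) (crd y).
Proof.
rewrite tformE /cform; elim: fsupp => [|[[i j] c] s IHs];
  by rewrite ?big_nil // big_cons IHs.
Qed.

Lemma eq_cform X X' Y Y' :
  {in [pred i | 0 < i <= n], X =1 X'}%N ->
  {in [pred i | 0 < i <= n], Y =1 Y'}%N ->
  cform fsupp X Y = cform fsupp X' Y'.
Proof.
move=> eX eY; rewrite /cform.
have : {subset fsupp <= fsupp} by [].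
elim: {1 3 4}fsupp => //= -[[i j] c] s IHs sS.
have /fsupp_bound/= /andP[i_n j_n] := sS _ (mem_head _ _).
by rewrite eX // eY // IHs // => t ts; rewrite sS // inE ts orbT.
Qed.

Lemma tjacobiP :
  all (fun t => (0 < t.1.1.1 <= n)%N && (0 < t.1.1.2 <= n)%N) T ->
  (forall X Y Z l, l \in iota 1 n ->
     cbracket X (cbracket Y Z) l + cbracket Y (cbracket Z X) l
       + cbracket Z (cbracket X Y) l = 0) ->
  tjacobi.
Proof.
move=> T_n J x y z; apply: crd_eqP => l l_n.
have /andP[l0 ln] : (0 < l <= n)%N by move: l_n; rewrite mem_iota add1n ltnS.
have E u v w : crd (tbracket u (tbracket v w)) l =
    cbracket (crd u) (cbracket (crd v) (crd w)) l.
  rewrite crd_tbracket ?l0 //; apply: eq_cbracket => // i i_n.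
  exact: crd_tbracket.
by rewrite crd0 !crdD !E J.
Qed.

Lemma tinvariantP :
  (forall X Y Z, cform fsupp (cbracket X Y) Z = cform fsupp X (cbracket Y Z)) ->
  tinvariant.
Proof.
move=> I x y z; rewrite !tform_cform.
rewrite (@eq_cform _ (cbracket (crd x) (crd y)) _ (crd z)) //; last first.
  by move=> i i_n; apply: crd_tbracket.
by rewrite I; apply/esym/eq_cform => // i i_n; apply: crd_tbracket.
Qed.

End Tables.

Local Ltac jacobi_tac :=
  apply: tjacobiP => // X Y Z l; rewrite !inE; repeat case/orP;
  move/eqP=> ->; rewrite /cbracket /=; ring.

Local Ltac invariant_tac :=
  apply: tinvariantP => X Y Z;
  match goal with |- context [fsupp ?m ?f] =>
    let s := eval vm_compute in (fsupp m f) in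
    rewrite (_ : fsupp m f = s); last by vm_compute
  end;
  rewrite /cform /cbracket /= ?NegzE; ring.

Local Ltac nondegenerate_tac := by apply: tform_nondegenerate; vm_compute.

Section Algebras.
Variable K : fieldType.

(* [a_i, a_j] = c a_k *)
Local Notation br i j c k := (i%N, j%N, (c%R : int), k%N).

Definition n11_products : seq (nat * nat * int * nat) :=
  [::].
Definition n11_form (_ _ : nat) : int :=
  1.

Fact n11_jacobi : tjacobi K 0 n11_products.
Proof. jacobi_tac. Qed.
Fact n11_invariant : tinvariant K 0 n11_products n11_form.
Proof. invariant_tac. Qed.
Fact n11_nondegenerate : tnondegenerate K 0 n11_form.
Proof. nondegenerate_tac. Qed.

Definition n11 : quadLie K :=
  tquad n11_jacobi n11_invariant n11_nondegenerate.

Definition n23_products :=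
  [:: br 2 1 1 3; br 3 1 1 4; br 3 2 1 5].
Definition n23_form (i j : nat) : int :=
  if (i + j == 6)%N then (-1) ^+ i.-1 else 0.

Fact n23_jacobi : tjacobi K 4 n23_products.
Proof. jacobi_tac. Qed.
Fact n23_invariant : tinvariant K 4 n23_products n23_form.
Proof. invariant_tac. Qed.
Fact n23_nondegenerate : tnondegenerate K 4 n23_form.
Proof. nondegenerate_tac. Qed.

Definition n23 : quadLie K :=
  tquad n23_jacobi n23_invariant n23_nondegenerate.

Definition n25_1_products :=
  [:: br 2 1 1 3; br 3 1 1 4; br 4 1 1 5; br 5 1 1 6; br 5 2 1 7;
      br 3 4 1 7].
Definition n25_1_form (i j : nat) : int :=
  if (i + j == 8)%N then (-1) ^+ i else 0.

Fact n25_1_jacobi : tjacobi K 6 n25_1_products.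
Proof. jacobi_tac. Qed.
Fact n25_1_invariant : tinvariant K 6 n25_1_products n25_1_form.
Proof. invariant_tac. Qed.
Fact n25_1_nondegenerate : tnondegenerate K 6 n25_1_form.
Proof. nondegenerate_tac. Qed.

Definition n25_1 : quadLie K :=
  tquad n25_1_jacobi n25_1_invariant n25_1_nondegenerate.

Definition n25_2_products :=
  [:: br 2 1 1 3; br 3 1 1 4; br 3 2 1 5; br 4 1 1 6; br 6 1 1 7;
      br 6 2 1 8; br 2 5 (-1) 6; br 4 3 (-1) 8; br 5 3 1 7].
Definition n25_2_form (i j : nat) : int :=
  if [&& 1 <= i, i <= 3 & i + j == 9]%N then (-1) ^+ i
  else if (i, j) \in [:: (4, 4); (5, 5)]%N then 1
  else 0.

Fact n25_2_jacobi : tjacobi K 7 n25_2_products.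
Proof. jacobi_tac. Qed.
Fact n25_2_invariant : tinvariant K 7 n25_2_products n25_2_form.
Proof. invariant_tac. Qed.
Fact n25_2_nondegenerate : tnondegenerate K 7 n25_2_form.
Proof. nondegenerate_tac. Qed.

Definition n25_2 : quadLie K :=
  tquad n25_2_jacobi n25_2_invariant n25_2_nondegenerate.

Definition n32_products :=
  [:: br 2 1 1 4; br 3 1 1 5; br 3 2 1 6].
Definition n32_form (i j : nat) : int :=
  if (i + j == 7)%N then (-1) ^+ i.-1 else 0.

Fact n32_jacobi : tjacobi K 5 n32_products.
Proof. jacobi_tac. Qed.
Fact n32_invariant : tinvariant K 5 n32_products n32_form.
Proof. invariant_tac. Qed.
Fact n32_nondegenerate : tnondegenerate K 5 n32_form.
Proof. nondegenerate_tac. Qed.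

Definition n32 : quadLie K :=
  tquad n32_jacobi n32_invariant n32_nondegenerate.

Definition n33_1_products :=
  [:: br 2 1 1 4; br 3 1 1 5; br 4 1 1 6; br 4 2 1 7; br 5 1 1 8;
      br 5 3 1 7].
Definition n33_1_form (i j : nat) : int :=
  if (i, j) \in [:: (4, 4); (5, 5); (1, 7)]%N then 1
  else if (i, j) \in [:: (2, 6); (3, 8)]%N then -1
  else 0.

Fact n33_1_jacobi : tjacobi K 7 n33_1_products.
Proof. jacobi_tac. Qed.
Fact n33_1_invariant : tinvariant K 7 n33_1_products n33_1_form.
Proof. invariant_tac. Qed.
Fact n33_1_nondegenerate : tnondegenerate K 7 n33_1_form.
Proof. nondegenerate_tac. Qed.

Definition n33_1 : quadLie K :=
  tquad n33_1_jacobi n33_1_invariant n33_1_nondegenerate.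

Definition n33_2_products :=
  [:: br 2 1 1 4; br 3 1 1 5; br 3 2 1 6; br 4 1 1 7; br 4 2 1 8;
      br 5 1 1 9; br 5 3 1 8; br 6 3 (-1) 7; br 6 2 1 9].
Definition n33_2_form (i j : nat) : int :=
  if (i, j) \in [:: (4, 4); (5, 5); (6, 6); (1, 8)]%N then 1
  else if (i, j) \in [:: (2, 7); (3, 9)]%N then -1
  else 0.

Fact n33_2_jacobi : tjacobi K 8 n33_2_products.
Proof. jacobi_tac. Qed.
Fact n33_2_invariant : tinvariant K 8 n33_2_products n33_2_form.
Proof. invariant_tac. Qed.
Fact n33_2_nondegenerate : tnondegenerate K 8 n33_2_form.
Proof. nondegenerate_tac. Qed.

Definition n33_2 : quadLie K :=
  tquad n33_2_jacobi n33_2_invariant n33_2_nondegenerate.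

End Algebras.

(* Main.v *)
(* A quadratic nilpotent Lie algebra generated by x_0, ..., x_(d-1) is determined, up to
   isometry, by the values B(x_i, w) of its form on iterated brackets w of the generators:
   by invariance these give all the values B(w, w'), and the form is nondegenerate.
   Nilpotency leaves finitely many of them to normalise.

   For two generators and nilindex at most 5, with z = [x_0, x_1], what remains is the Gram
   matrix of the x_i, the number B(z, z) and the symmetric matrix S of B([x_i, z], [x_j, z]),
   which a change of generators g turns into det(g)^2 g S g^T.  For three generators and
   nilindex at most 3 it is the Gram matrix of the x_i, the number B(x_0, [x_1, x_2]) and
   the Gram matrix E of the brackets, on which g acts through its cofactor matrix.  Over an
   algebraically closed field S and E become partial identity matrices; adding to a generator
   an element of n^3 (resp. n^2) then kills B(z, z) (resp. B(x_0, [x_1, x_2])) as soon as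
   S (resp. E) is nonzero, and adding central elements kills the Gram matrix of the x_i, since
   in an indecomposable algebra of dimension at least 2 the centre is totally isotropic.

   If n = U + W is a decomposition then type n >= type U + type W, and a nilpotent
   algebra of type 1 is a line.  So type at most 2 forces n to be abelian, and in type 3 one
   of the summands is spanned by a central anisotropic vector, which can be taken as a
   generator. *)

Require Import Defs.
From HB Require Import structures.
From mathcomp Require Import all_boot all_order all_algebra.
From mathcomp Require Import ring zify.
Import GRing.Theory.
Local Open Scope ring_scope.

Set Implicit Arguments.
Unset Strict Implicit.
Unset Printing Implicit Defensive.

Local Open Scope lie_scope.

Local Notation "''B(' u , v )" := (quad_form _ u v)
  (at level 2, u, v at level 99, format "''B(' u ,  v )").

(** * Congruence of symmetric matrices *)

(** In the rank factorisation of a row of rank 1 the left factor is a nonzero scalar, so the first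
    row of the right factor is proportional to [v]. *)
Lemma row_completion (F : fieldType) n (v : 'rV[F]_n.+1) : v != 0 ->
  exists2 P, P \in unitmx & exists2 c, c != 0 & row 0 P = c *: v.
Proof.
move=> v0; have r1 : \rank v = 1%N by rewrite rank_rV v0.
have := mulmx_ebase v; rewrite r1.
rewrite [col_ebase v]mx11_scalar mul_scalar_mx -scalemxAl.
have -> : pid_mx 1 = delta_mx 0 0 :> 'M[F]_(1, n.+1).
  by apply/matrixP => i [[|j] j_n]; rewrite !mxE ord1.
rewrite -rowE; set c := col_ebase v 0 0 => vE.
have c0 : c != 0.
  by apply: contraNneq v0 => c0; rewrite -vE c0 scale0r.
exists (row_ebase v); first exact: row_ebase_unit.
exists c^-1; rewrite ?invr_eq0 //.
by rewrite -[X in _ *: X]vE scalerA mulVf // scale1r.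
Qed.

Lemma closed_root (F : closedFieldType) n (a : F) : (0 < n)%N ->
  exists x, x ^+ n = a.
Proof.
case: n => // n _.
have [x] := @solve_monicpoly F n.+1 (fun i => if i == 0%N then a else 0) isT.
rewrite big_ord_recl /= mulr1 big1 ?addr0; first by exists x.
by move=> i _; rewrite mul0r.
Qed.

Section SmallDeterminants.
Variable F : fieldType.

(** Small determinants are explicit polynomials, which [ring] and [field] can work with once
    unfolded. *)
Definition det2 (a b c d : F) := a * d - b * c.

(** The entries are written as [sum2E] expands a matrix product, including the trailing [+ 0], so
    that [det2_unit] can rewrite with this identity. *)
Lemma det2M (a b c d a' b' c' d' : F) :
  det2 (a * a' + (b * c' + 0)) (a * b' + (b * d' + 0))
       (c * a' + (d * c' + 0)) (c * b' + (d * d' + 0))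
  = det2 a b c d * det2 a' b' c' d'.
Proof. by rewrite /det2; ring. Qed.

Definition det3 (a b c d e f g h i : F) :=
  a * (e * i - f * h) + b * (f * g - d * i) + c * (d * h - e * g).

Lemma det3M (a b c d e f g h i a' b' c' d' e' f' g' h' i' : F) :
  det3 (a * a' + (b * d' + (c * g' + 0))) (a * b' + (b * e' + (c * h' + 0)))
         (a * c' + (b * f' + (c * i' + 0)))
       (d * a' + (e * d' + (f * g' + 0))) (d * b' + (e * e' + (f * h' + 0)))
         (d * c' + (e * f' + (f * i' + 0)))
       (g * a' + (h * d' + (i * g' + 0))) (g * b' + (h * e' + (i * h' + 0)))
         (g * c' + (h * f' + (i * i' + 0)))
  = det3 a b c d e f g h i * det3 a' b' c' d' e' f' g' h' i'.
Proof. by rewrite /det3; ring. Qed.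

Lemma sum2E (f : 'I_2 -> F) : \sum_i f i = f 0 + (f 1 + 0).
Proof. by rewrite !big_ord_recl big_ord0; congr (f _ + (f _ + 0)); apply/val_inj. Qed.

Lemma sum3E (f : 'I_3 -> F) : \sum_i f i = f 0 + (f 1 + (f 2 + 0)).
Proof.
by rewrite !big_ord_recl big_ord0; congr (f _ + (f _ + (f _ + 0))); apply/val_inj.
Qed.

(** A multiplicative polynomial with value 1 at the identity cannot vanish at an invertible
    matrix. *)
Lemma det2_unit (h : 'M[F]_2) : h \in unitmx ->
  det2 (h 0 0) (h 0 1) (h 1 0) (h 1 1) != 0.
Proof.
pose D (A : 'M[F]_2) := det2 (A 0 0) (A 0 1) (A 1 0) (A 1 1).
move=> hu; have DM : D (h *m invmx h) = D h * D (invmx h).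
  by rewrite -det2M /D !mxE !sum2E.
rewrite -/(D h); apply/eqP => Dh; move: DM.
rewrite mulmxV // Dh mul0r /D /det2 !mxE /= mulr1 mul0r subr0 => /eqP.
by rewrite oner_eq0.
Qed.

Lemma det3_unit (h : 'M[F]_3) : h \in unitmx ->
  det3 (h 0 0) (h 0 1) (h 0 2) (h 1 0) (h 1 1) (h 1 2) (h 2 0) (h 2 1) (h 2 2) != 0.
Proof.
pose D (A : 'M[F]_3) :=
  det3 (A 0 0) (A 0 1) (A 0 2) (A 1 0) (A 1 1) (A 1 2) (A 2 0) (A 2 1) (A 2 2).
move=> hu; have DM : D (h *m invmx h) = D h * D (invmx h).
  by rewrite -det3M /D !mxE !sum3E.
rewrite -/(D h); apply/eqP => Dh; move: DM.
rewrite mulmxV // Dh mul0r /D /det3 !mxE /= !(mulr1, mulr0, mul0r, subr0, addr0) => /eqP.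
by rewrite oner_eq0.
Qed.

End SmallDeterminants.

Section Congruence.
Variable F : closedFieldType.
Hypothesis two : (2%:R : F) != 0.

(** If [S i j] is nonzero, the form is nonzero at [e_i], at [e_j], or, when [S i i] and [S j j] both
    vanish, at [e_i + e_j], where it equals [2 S i j]. By [row_completion] a multiple of this vector
    is the first row of some invertible [P]. *)
Lemma congruence_nonzero n (S : 'M[F]_n.+1) : S^T = S -> S != 0 ->
  exists2 P, P \in unitmx & (P *m S *m P^T) 0 0 != 0.
Proof.
move=> Ssym S0.
have SC i j : S i j = S j i by rewrite -[in LHS]Ssym mxE.
have e_form i j : (delta_mx 0 i *m S *m (delta_mx 0 j)^T : 'M_1) 0 0 = S i j.
  by rewrite trmx_delta -rowE -colE !mxE.
suff [v vS] : exists v : 'rV_n.+1, (v *m S *m v^T) 0 0 != 0.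
  have v0 : v != 0 by apply: contraNneq vS => ->; rewrite !mul0mx mxE.
  have [P Pu [c c0 Pv]] := row_completion v0; exists P => //.
  have -> : (P *m S *m P^T) 0 0 = (row 0 P *m S *m (row 0 P)^T) 0 0.
    by rewrite tr_row -!row_mul !mxE; apply: eq_bigr => k _; rewrite !mxE.
  by rewrite Pv linearZ /= -!scalemxAl -scalemxAr scalerA mxE !mulf_neq0.
have [i [j Sij]] : exists i j, S i j != 0.
  have /existsP[i /existsP[j Sij]] : [exists i, exists j, S i j != 0].
    apply: contraNT S0; rewrite negb_exists => /forallP H.
    apply/eqP/matrixP => i j; have := H i; rewrite negb_exists mxE.
    by move=> /forallP/(_ j); rewrite negbK => /eqP.
  by exists i, j.
have [Sii|Sii] := eqVneq (S i i) 0; last by exists (delta_mx 0 i); rewrite e_form.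
have [Sjj|Sjj] := eqVneq (S j j) 0; last by exists (delta_mx 0 j); rewrite e_form.
exists (delta_mx 0 i + delta_mx 0 j).
rewrite linearD /= !mulmxDl !mulmxDr.
have E A B C D : ((A + B) + (C + D) : 'M[F]_1) 0 0 = A 0 0 + B 0 0 + (C 0 0 + D 0 0).
  by rewrite !mxE.
rewrite E !e_form Sii Sjj (SC j i) add0r addr0 -mulr2n -mulr_natl.
by rewrite mulf_neq0.
Qed.

(** Induction on the size: a nonzero value is moved to the corner, its square root [m] scales it to
    1, and the induction hypothesis applies to the Schur complement [C]. *)
Lemma symmetric_congruence n (S : 'M[F]_n) : S^T = S ->
  exists2 h, h \in unitmx & exists r, h *m S *m h^T = pid_mx r.
Proof.
elim: n S => [|n IH] S Ssym.
  by exists 1%:M; rewrite ?unitmx1 //; exists 0%N; apply/matrixP => -[].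
have [->|S0] := eqVneq S 0.
  by exists 1%:M; rewrite ?unitmx1 //; exists 0%N; rewrite mulmx0 mul0mx pid_mx_0.
have [P Pu] := congruence_nonzero Ssym S0.
set T := P *m S *m P^T => a0.
have Tsym : T^T = T by rewrite /T !trmx_mul trmxK Ssym mulmxA.
have TE0 : T = P *m S *m P^T by [].
clearbody T.
have [m m2] := closed_root (T 0 0) (isT : (0 < 2)%N).
have m0 : m != 0 by apply: contraNneq a0 => m0; rewrite -m2 m0 expr0n.
(* The size is rewritten as [1 + n] so that block matrices typecheck. *)
move: S Ssym S0 P Pu T TE0 Tsym a0 m2; rewrite -[n.+1]/(1 + n)%N.
move=> S Ssym S0 P Pu T TE0 Tsym a0 m2.
pose b := ursubmx T; pose C := drsubmx T - m^-2 *: (b^T *m b).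
have TE : T = block_mx (m ^+ 2)%:M b b^T (drsubmx T).
  rewrite -[LHS]submxK; congr block_mx; last by rewrite -[in LHS]Tsym trmx_ursub.
  by rewrite [LHS]mx11_scalar !mxE m2; congr (T _ _)%:M; apply/val_inj.
have Csym : C^T = C.
  by rewrite linearB linearZ /= trmx_mul trmxK -[in LHS]Tsym trmx_drsub trmxK.
have [h hu [r hr]] := IH C Csym.
(* [Q] divides the first row by [m] and clears the rest of the first column. *)
pose Q : 'M_(1 + n) := block_mx m^-1%:M 0 (- m^-2 *: b^T) 1%:M.
have QT : Q *m T *m Q^T = block_mx 1%:M 0 0 C.
  rewrite TE /Q tr_block_mx !mulmx_block !tr_scalar_mx.
  rewrite !(mul_scalar_mx, mul_mx_scalar, trmx0, mulmx0, mul0mx, addr0, add0r, trmx1, mulmx1,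
    mul1mx).
  have E : m ^+ 2 *: (- m ^- 2 *: b^T) + 1 *: b^T = 0.
    by rewrite scalerA mulrN mulfV ?expf_neq0 // scaleN1r scale1r addNr.
  have Et : (- m ^- 2 *: b^T)^T = - m ^- 2 *: b by rewrite linearZ /= trmxK.
  rewrite E Et mul0mx scaler0 add0r !scale1r; congr block_mx.
  - by rewrite !scale_scalar_mx; congr _%:M; field.
  - rewrite -scalemxAl mul_scalar_mx !scalerA -scalerDl.
    by rewrite [X in X *: _](_ : _ = 0) ?scale0r //; field.
  - by rewrite /C addrC scaleNr ?mulNmx ?scalemxAl. 
pose R : 'M_(1 + n) := block_mx 1%:M 0 0 h.
exists (R *m Q *m P).
  rewrite !unitmx_mul Pu andbT /R /Q unitmxE [X in _ && X]unitmxE.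
  rewrite det_ublock det_lblock !det1 mul1r mulr1 -unitmxE hu /= det_scalar1.
  by rewrite unitrV unitfE.
exists r.+1.
rewrite !trmx_mul !mulmxA -(mulmxA R Q P) -(mulmxA R) -(mulmxA R) -(mulmxA R) -(mulmxA R).
have -> : Q *m P *m S *m P^T *m Q^T = Q *m T *m Q^T by rewrite TE0 !mulmxA.
rewrite QT /R tr_block_mx !mulmx_block.
rewrite !(trmx0, mulmx0, mul0mx, addr0, add0r, trmx1, mulmx1, mul1mx) mulmxA hr.
apply/matrixP => i j; rewrite !mxE.
case: splitP => [i' ->|i' ->]; rewrite !mxE; case: splitP => [j' ->|j' ->];
  by rewrite !mxE ?ord1 //= ?eqn_add2l.
Qed.

(** [s i j k l] is the value on the rows (i, j) and (k, l) of the symmetric form with entries p, q,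
    r; the three cases are the ranks 2, 1 and 0. *)
Lemma congruence2 (p q r : F) : exists a b c d : F, let s i j k l :=
    i * k * p + (i * l + j * k) * q + j * l * r in
  det2 a b c d != 0 /\
  [\/ [/\ s a b a b = 1, s a b c d = 0 & s c d c d = 1],
      [/\ s a b a b = 1, s a b c d = 0 & s c d c d = 0] |
      [/\ s a b a b = 0, s a b c d = 0 & s c d c d = 0]].
Proof.
pose S : 'M[F]_2 := \matrix_(i, j) [:: p; q; r]`_(i + j).
have Ssym : S^T = S by apply/matrixP => i j; rewrite !mxE addnC.
have [h hu [k hk]] := symmetric_congruence Ssym.
exists (h 0 0), (h 0 1), (h 1 0), (h 1 1) => s.
have hE i j : s (h i 0) (h i 1) (h j 0) (h j 1) = (pid_mx k : 'M_2) i j.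
  rewrite -hk !mxE !sum2E !mxE !sum2E !mxE /s /=.
  move: (h i 0) (h i 1) (h j 0) (h j 1) => a b c d; ring.
split; first exact: det2_unit.
rewrite !hE !mxE /=; case: k {hk hE} => [|[|k]] /=;
  [constructor 3 | constructor 2 | constructor 1] => //.
Qed.

Lemma congruence3 (E00 E01 E02 E11 E12 E22 : F) :
  exists h00 h01 h02 h10 h11 h12 h20 h21 h22 : F,
  let s i j k l m n := i * l * E00 + j * m * E11 + k * n * E22
    + (i * m + j * l) * E01 + (i * n + k * l) * E02 + (j * n + k * m) * E12 in
  det3 h00 h01 h02 h10 h11 h12 h20 h21 h22 != 0 /\
  exists r, [/\ [/\ s h00 h01 h02 h00 h01 h02 = (0 < r)%N%:R,
    s h10 h11 h12 h10 h11 h12 = (1 < r)%N%:R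
    & s h20 h21 h22 h20 h21 h22 = (2 < r)%N%:R],
    s h00 h01 h02 h10 h11 h12 = 0,
    s h00 h01 h02 h20 h21 h22 = 0
    & s h10 h11 h12 h20 h21 h22 = 0].
Proof.
(* Off the diagonal, [(i + j).-1] numbers the pairs 01, 02, 12 as 0, 1, 2. *)
pose S : 'M[F]_3 := \matrix_(i, j)
  (if i == j :> nat then [:: E00; E11; E22]`_i else [:: E01; E02; E12]`_(i + j).-1).
have Ssym : S^T = S.
  by apply/matrixP => i j; rewrite !mxE addnC eq_sym; case: eqP => // ->.
have [h hu [r hr]] := symmetric_congruence Ssym.
exists (h 0 0), (h 0 1), (h 0 2), (h 1 0), (h 1 1), (h 1 2), (h 2 0), (h 2 1), (h 2 2) => s.
have hE i j : s (h i 0) (h i 1) (h i 2) (h j 0) (h j 1) (h j 2) = (pid_mx r : 'M_3) i j.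
  rewrite -hr !mxE !sum3E !mxE !sum3E !mxE /s /=.
  by move: (h i 0) (h i 1) (h i 2) (h j 0) (h j 1) (h j 2) => a b c d e f; ring.
split; first exact: det3_unit.
by exists r; rewrite !hE !mxE.
Qed.

End Congruence.

(** * Brackets, forms and the lower central series *)

Section Bracket.
Variables (K : fieldType) (L : lieAlgebra K).
Implicit Types (x y z u v : L) (U V W : {vspace L}).

Lemma br0r x : [lie x, 0] = 0. Proof. exact: linear0r. Qed.
Lemma br0l x : [lie 0, x] = 0. Proof. exact: linear0l. Qed.
Lemma brDr x y z : [lie x, y + z] = [lie x, y] + [lie x, z].
Proof. exact: linearDr. Qed.
Lemma brDl x y z : [lie x + y, z] = [lie x, z] + [lie y, z].
Proof. exact: linearDl. Qed.
Lemma brZr a x y : [lie x, a *: y] = a *: [lie x, y].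
Proof. exact: linearZr_LR. Qed.
Lemma brZl a x y : [lie a *: x, y] = a *: [lie x, y].
Proof. exact: linearZl_LR. Qed.
Lemma brNr x y : [lie x, - y] = - [lie x, y]. Proof. exact: linearNr. Qed.
Lemma brNl x y : [lie - x, y] = - [lie x, y]. Proof. exact: linearNl. Qed.
Lemma br_sumr I r (P : pred I) (F : I -> L) x :
  [lie x, \sum_(i <- r | P i) F i] = \sum_(i <- r | P i) [lie x, F i].
Proof. exact: linear_sumr. Qed.
Lemma br_suml I r (P : pred I) (F : I -> L) x :
  [lie \sum_(i <- r | P i) F i, x] = \sum_(i <- r | P i) [lie F i, x].
Proof. exact: linear_sumlz. Qed.

Lemma brr x : [lie x, x] = 0. Proof. exact: lie_alternating. Qed.

Lemma brC x y : [lie x, y] = - [lie y, x].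
Proof.
have := brr (x + y); rewrite brDl !brDr !brr add0r addr0 => /eqP.
by rewrite addr_eq0 => /eqP.
Qed.

Lemma br_ad x y z : [lie x, [lie y, z]] = [lie [lie x, y], z] + [lie y, [lie x, z]].
Proof.
have /eqP := lie_jacobi x y z; rewrite -addrA addr_eq0 => /eqP->.
by rewrite (brC z x) brNr (brC z [lie x, y]) -opprD opprK addrC.
Qed.

(** A condition on [[x, y]] becomes membership of [y] in a subspace, which can then be checked on a
    spanning set. *)
Definition ad_preim x U := (linfun (lie_bracket L x) @^-1: U)%VS.

Lemma mem_ad_preim x U y : (y \in ad_preim x U) = ([lie x, y] \in U).
Proof. by rewrite -memv_preim lfunE. Qed.

Local Notation lc := (lower_central L).

Lemma lc_full i x : (i <= 1)%N -> x \in lc i.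
Proof. by case: i => [|[|]] // _; apply: memvf. Qed.

Lemma lcSl i x y : x \in lc i -> [lie x, y] \in lc i.+1.
Proof.
case: i => [|i] xi; first exact: memvf.
by have /lie_prodvP := subvv (lie_prodv (lc i.+1) fullv); apply=> //; apply: memvf.
Qed.

Lemma lcSr i x y : x \in lc i -> [lie y, x] \in lc i.+1.
Proof. by move=> xi; rewrite brC memvN lcSl. Qed.

Lemma lc_ind i U : (forall x y, x \in lc i.+1 -> [lie x, y] \in U) ->
  (lc i.+2 <= U)%VS.
Proof. by move=> H; apply/lie_prodvP => x y xi _; apply: H. Qed.

Lemma lcSS i : (lc i.+1 <= lc i)%VS.
Proof.
elim: i => [|[|i] IH]; rewrite ?subvf //.
by apply: lc_ind => x y xi; apply/lcSl/(subvP IH).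
Qed.

Lemma lcS i j : (i <= j)%N -> (lc j <= lc i)%VS.
Proof.
move/subnK <-; elim: (j - i)%N => [|k IH]; rewrite ?subvv //.
exact: subv_trans (lcSS _) IH.
Qed.

Lemma lc_mem i j x : x \in lc j -> (i <= j)%N -> x \in lc i.
Proof. by move=> xj /lcS/subvP; apply. Qed.

(** Induction on [j], since by the Jacobi identity [ad x] is a derivation. The junk value at index 0
    is harmless, as n^(i+1) lies in n^i. *)
Lemma lc_br i j x y : x \in lc i -> y \in lc j -> [lie x, y] \in lc (i + j).
Proof.
elim: j i x y => [|[|j] IH] i x y xi yj.
- by apply: lc_mem (lcSl _ xi) _; rewrite addn0.
- by rewrite addn1 lcSl.
rewrite -mem_ad_preim; apply: subvP yj; apply: lc_ind => u v uj.
rewrite mem_ad_preim br_ad memvD //.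
  by rewrite -addSnnS addSn lcSl // IH.
rewrite brC memvN.
by rewrite -addSnnS IH // lcSl.
Qed.

End Bracket.

Section Form.
Variables (K : fieldType) (L : quadLie K).
Implicit Types (x y z u v : L) (U V W : {vspace L}).
Local Notation lc := (lower_central L).

Lemma fmC x y : 'B(x, y) = 'B(y, x).
Proof. by rewrite hermC expr0 mul1r. Qed.
Lemma fm0r x : 'B(x, 0) = 0. Proof. exact: linear0r. Qed.
Lemma fm0l x : 'B(0, x) = 0. Proof. exact: linear0l. Qed.
Lemma fmDr x y z : 'B(x, y + z) = 'B(x, y) + 'B(x, z).
Proof. exact: linearDr. Qed.
Lemma fmDl x y z : 'B(x + y, z) = 'B(x, z) + 'B(y, z).
Proof. exact: linearDl. Qed.
Lemma fmZr a x y : 'B(x, a *: y) = a * 'B(x, y).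
Proof. exact: linearZr_LR. Qed.
Lemma fmZl a x y : 'B(a *: x, y) = a * 'B(x, y).
Proof. exact: linearZl_LR. Qed.
Lemma fmNr x y : 'B(x, - y) = - 'B(x, y). Proof. exact: linearNr. Qed.
Lemma fmNl x y : 'B(- x, y) = - 'B(x, y). Proof. exact: linearNl. Qed.
Lemma fm_sumr I r (P : pred I) (F : I -> L) x :
  'B(x, \sum_(i <- r | P i) F i) = \sum_(i <- r | P i) 'B(x, F i).
Proof. exact: linear_sumr. Qed.
Lemma fm_suml I r (P : pred I) (F : I -> L) x :
  'B(\sum_(i <- r | P i) F i, x) = \sum_(i <- r | P i) 'B(F i, x).
Proof. exact: linear_sumlz. Qed.

Lemma fm_inv x y z : 'B([lie x, y], z) = 'B(x, [lie y, z]).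
Proof. exact: quad_invariant. Qed.

Lemma fm_adj x y z : 'B([lie x, y], z) = - 'B(y, [lie x, z]).
Proof. by rewrite brC fmNl fm_inv. Qed.

Lemma fm_eq0 x : (forall y, 'B(x, y) = 0) -> x = 0.
Proof. exact/nondegenerate_eq0/quad_nondegenerate. Qed.

Lemma fm_orth U x :
  (forall u, u \in U -> 'B(x, u) = 0) <-> (U <= orthov (quad_form L) <[x]>)%VS.
Proof.
split=> [H|/subvP H u /H].
  by apply/subvP => u uU; rewrite mem_orthov1 fmC H.
by rewrite mem_orthov1 fmC => /eqP.
Qed.

(** Invariance moves the brackets of [x] onto [y] one at a time, until [y] lies in n^N = 0. *)
Lemma lc_perp N i j x y : lc N = 0%VS -> (N < i + j)%N ->
  x \in lc i -> y \in lc j -> 'B(x, y) = 0.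
Proof.
move=> lc0; elim: i j x y => [|[|i] IH] j x y Nij xi yj.
- have : y \in lc N by apply: lc_mem yj _; lia.
  by rewrite lc0 memv0 => /eqP->; rewrite fm0r.
- have : y \in lc N by apply: lc_mem yj _; lia.
  by rewrite lc0 memv0 => /eqP->; rewrite fm0r.
have /fm_orth H : (lc i.+2 <= orthov (quad_form L) <[y]>)%VS.
  apply: lc_ind => u v ui; rewrite mem_orthov1 fm_inv.
  by rewrite (IH j.+1) //; [lia | apply: lcSr].
by rewrite fmC H.
Qed.

(** With [orth_central]: the centre is the orthogonal of n^2, because B([z, y], v) = B(z, [y, v])
    and the form is nondegenerate. *)
Lemma central_orth z : (forall u, u \in lc 2 -> 'B(z, u) = 0) ->
  forall y, [lie z, y] = 0.
Proof.
by move=> Hz y; apply: fm_eq0 => v; rewrite fm_inv Hz // lcSl // lc_full.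
Qed.

Lemma orth_central z : (forall y, [lie z, y] = 0) ->
  forall u, u \in lc 2 -> 'B(z, u) = 0.
Proof.
move=> Hz; apply/fm_orth; apply: lc_ind => u v _.
by rewrite mem_orthov1 fmC -fm_inv Hz fm0l.
Qed.

End Form.

(** * Words in generators *)

Section Words.
Variables (K : fieldType) (L : lieAlgebra K) (d : nat) (x : 'I_d -> L).
Local Notation lc := (lower_central L).

(** Only modulo n^2; in a nilpotent algebra this already makes the family generate
    ([words_full]). *)
Definition spans := forall v : L, exists c : 'I_d -> K,
  v - \sum_i c i *: x i \in lc 2.

Definition word (w : seq 'I_d) k := foldr (fun i v => [lie x i, v]) (x k) w.

Lemma word_lc w k : word w k \in lc (size w).+1.
Proof. by elim: w => [|i w IH]; [apply: memvf | apply: lcSr]. Qed.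

(** The span of all words, described by its universal property. A finite sum suffices, because words
    with [size w >= N] lie in n^(N+1) = 0. *)
Lemma word_space : lie_nilpotent L -> exists2 G : {vspace L},
    forall w k, word w k \in G
  & forall U : {vspace L}, (forall w k, word w k \in U) -> (G <= U)%VS.
Proof.
move=> [N lcN].
exists (\sum_(n < N) \sum_(w : n.-tuple 'I_d) \sum_k <[word w k]>)%VS.
  move=> w k; have [wN|Nw] := ltnP (size w) N; last first.
    have : word w k \in lc N.+1 by apply: lc_mem (word_lc w k) _; lia.
    by rewrite lcN memv0 => /eqP->; apply: mem0v.
  rewrite memvE; apply: (sumv_sup (Ordinal wN)) => //=.
  by apply: (sumv_sup (in_tuple w)) => //; apply: (sumv_sup k) => //.
move=> U wU; apply/subv_sumP => n _; apply/subv_sumP => w _.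
by apply/subv_sumP => k _; rewrite -memvE.
Qed.

(** Each n^k lies in U + n^(k+1): in [[y, u]], replace [u] by a combination of generators up to n^2,
    and [y] by an element of U up to the next term of the series. Nilpotency ends the descent. *)
Lemma spans_full (U : {vspace L}) : lie_nilpotent L -> spans ->
  (forall i, x i \in U) -> (forall i v, v \in U -> [lie x i, v] \in U) ->
  U = fullv.
Proof.
move=> [N lcN] sx xU adU; apply/eqP; rewrite eqEsubv subvf /=.
have sumU (c : 'I_d -> K) : \sum_i c i *: x i \in U.
  by apply: memv_suml => i _; apply: memvZ.
have step k : (lc k.+1 <= U + lc k.+2)%VS.
  elim: k => [|k IH].
    apply/subvP => v _; have [c vc] := sx v.
    by rewrite -(subrK (\sum_i c i *: x i) v) addrC memv_add.
  apply: lc_ind => y u yk; have [c uc] := sx u.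
  rewrite -(subrK (\sum_i c i *: x i) u) brDr addrC memvD //.
    rewrite br_sumr; apply: memv_suml => i _; rewrite brZr memvZ //.
    have /memv_addP[y1 y1U [y2 y2k ->]] := subvP IH _ yk.
    by rewrite brC memvN brDr memv_add // ?adU // lcSr.
  by apply: (subvP (addvSr _ _)); rewrite -[k.+3]addn2; apply: lc_br.
have all_k k : (fullv <= U + lc k.+1)%VS.
  elim: k => [|k IH]; first exact: addvSr.
  apply: subv_trans IH _; rewrite subv_add addvSl /=; exact: step.
by have := all_k N; rewrite lcN addv0.
Qed.

Lemma words_full (U : {vspace L}) : lie_nilpotent L -> spans ->
  (forall w k, word w k \in U) -> U = fullv.
Proof.
move=> nL sx wU; have [G wG GU] := word_space nL.
apply/eqP; rewrite eqEsubv subvf /=.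
rewrite -(@spans_full G) ?GU //; first by move=> i; apply: (wG [::]).
move=> i v vG; rewrite -mem_ad_preim; apply: subvP vG; apply: GU => w k.
by rewrite mem_ad_preim; apply: (wG (i :: w)).
Qed.

End Words.

Section OrthogonalSum.
Variables (K : fieldType) (L M : quadLie K).
Implicit Types (u v : osum L M).

Lemma osum_lc i u : u \in lower_central (osum L M) i ->
  u.1 \in lower_central L i /\ u.2 \in lower_central M i.
Proof.
pose p1 : 'Hom(osum L M, L) := linfun (fst : (L * M)%type -> L).
pose p2 : 'Hom(osum L M, M) := linfun (snd : (L * M)%type -> M).
pose V i := ((p1 @^-1: lower_central L i) :&: (p2 @^-1: lower_central M i))%VS.
have VE j v : (v \in V j) = (v.1 \in lower_central L j) && (v.2 \in lower_central M j).
  by rewrite memv_cap -!memv_preim !lfunE.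
move=> ui; apply/andP; rewrite -VE; apply: subvP ui.
elim: i => [|[|i] IH]; try by apply/subvP => v _; rewrite VE !memvf.
apply: lc_ind => v w /(subvP IH _); rewrite !VE => /andP[v1 v2].
by rewrite !lcSl.
Qed.

Lemma osum_lc0 N : lower_central L N = 0%VS -> lower_central M N = 0%VS ->
  lower_central (osum L M) N = 0%VS.
Proof.
move=> L0 M0; apply/eqP; rewrite -subv0; apply/subvP => -[u v] /osum_lc[/=].
by rewrite L0 M0 !memv0 => /eqP-> /eqP->.
Qed.

End OrthogonalSum.

Lemma nilpotent_lc (K : fieldType) (L : lieAlgebra K) N :
  lower_central L N = 0%VS -> lie_nilpotent L.
Proof.
by move=> L0; exists N; apply/eqP; rewrite -subv0 -L0 lcS.
Qed.

(** * Isometries from equal values on words *)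

Section DataIsometry.
Variables (K : fieldType) (L M : quadLie K) (d : nat).
Variables (x : 'I_d -> L) (y : 'I_d -> M).
Hypotheses (nL : lie_nilpotent L) (nM : lie_nilpotent M).
Hypotheses (sx : spans x) (sy : spans y).
Hypothesis data : forall i w k, 'B(x i, word x w k) = 'B(y i, word y w k).

Let N := osum L M.
Let g i : N := (x i, y i).

Let word_g w k : word g w k = (word x w k, word y w k).
Proof. by elim: w => //= i w ->. Qed.

(** Invariance moves the letters of [w] onto [w'], with the same signs on both sides, until a single
    generator is left. *)
Let data2 w k w' k' :
  'B(word x w k, word x w' k') = 'B(word y w k, word y w' k').
Proof.
elim: w w' => [|i w IH] w'; first exact: data.
by rewrite /= !fm_adj (IH (i :: w')).
Qed.

(* The span of the pairs (word in x, word in y) is the graph of the isometry. *)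
Lemma data_isometric : isometric L M.
Proof.
have [G wG GU] : exists2 G : {vspace N},
    forall w k, word g w k \in G
  & forall U : {vspace N}, (forall w k, word g w k \in U) -> (G <= U)%VS.
  apply: word_space; case: nL nM => [a La] [b Mb].
  apply: (@nilpotent_lc _ N (maxn a.+1 b.+1)).
  apply: osum_lc0; apply/eqP; rewrite -subv0.
    by rewrite -La lcS // leq_maxl.
  by rewrite -Mb lcS // leq_maxr.
have adG i v : v \in G -> [lie (g i : N), v] \in G.
  move=> vG; rewrite -mem_ad_preim; apply: subvP vG; apply: GU => w k.
  by rewrite mem_ad_preim; apply: (wG (i :: w)).
(* By Jacobi, bracketing with a word reduces to bracketing with generators, so [G] is a
   subalgebra. *)
have brG u v : u \in G -> v \in G -> [lie u, v] \in G.
  move=> uG vG; rewrite -mem_ad_preim; apply: subvP vG; apply: GU => w k.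
  rewrite mem_ad_preim; elim: w u uG => [|i w IH] u uG.
    by rewrite brC memvN; apply: adG.
  have -> : word g (i :: w) k = [lie (g i : N), word g w k] by [].
  by rewrite br_ad memvD ?adG ?IH // brC memvN adG.
(* The kernel of [F u] consists of the [v] for which the two components of [u] and [v] have equal
   products; this lets the equality of the forms on [G] be checked on words in each argument. *)
pose F (u : N) : 'Hom(N, K^o) :=
  ((linfun (applyr (quad_form L) u.1 : L -> K^o) \o linfun (fst : (L * M)%type -> L))
   - (linfun (applyr (quad_form M) u.2 : M -> K^o) \o linfun (snd : (L * M)%type -> M)))%VF.
have FE (u v : N) : (v \in lker (F u)) = ('B(u.1, v.1) == 'B(u.2, v.2)).
  by rewrite memv_ker add_lfunE opp_lfunE !comp_lfunE !lfunE /= subr_eq0 !(fmC u.1) !(fmC u.2).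
have FC (u v : N) : (v \in lker (F u)) = (u \in lker (F v)).
  by rewrite !FE fmC [X in _ == X]fmC.
have fmG u v : u \in G -> v \in G -> 'B(u.1, v.1) = 'B(u.2, v.2).
  move=> uG vG; apply/eqP; rewrite -FE.
  apply: subvP vG; apply: (GU) => w k; rewrite FC.
  apply: subvP uG; apply: GU => w' k'.
  by rewrite FE !word_g /= data2.
pose p : 'Hom(subvs_of G, L) := linfun ((fst : (L * M)%type -> L) \o (vsval : subvs_of G -> _)).
pose q : 'Hom(subvs_of G, M) := linfun ((snd : (L * M)%type -> M) \o (vsval : subvs_of G -> _)).
have pE u : p u = (vsval u).1 by rewrite lfunE.
have qE u : q u = (vsval u).2 by rewrite lfunE.
have p_full : limg p = fullv.
  apply: (words_full nL sx) => w k.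
  have -> : word x w k = p (vsproj G (word g w k)).
    by rewrite pE vsprojK // word_g.
  exact/memv_img/memvf.
have q_full : limg q = fullv.
  apply: (words_full nM sy) => w k.
  have -> : word y w k = q (vsproj G (word g w k)).
    by rewrite qE vsprojK // word_g.
  exact/memv_img/memvf.
have fmpq a b : 'B(p a, p b) = 'B(q a, q b) by rewrite !pE !qE fmG ?subvsP.
(* If [p a = 0] then [q a] is orthogonal to the image of [q], which is everything; so both
   components of [a] vanish. The same holds with [p] and [q] exchanged. *)
have p_inj : lker p == 0%VS.
  rewrite -subv0; apply/subvP => a; rewrite memv_ker memv0 => /eqP pa.
  suff qa : q a = 0.
    by apply/eqP/val_inj; rewrite /= [vsval a]surjective_pairing -pE -qE pa qa.
  apply: fm_eq0 => z; have /memv_imgP[b _ ->] : z \in limg q by rewrite q_full memvf.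
  by rewrite -fmpq pa fm0l.
have q_inj : lker q == 0%VS.
  rewrite -subv0; apply/subvP => a; rewrite memv_ker memv0 => /eqP qa.
  suff pa : p a = 0.
    by apply/eqP/val_inj; rewrite /= [vsval a]surjective_pairing -pE -qE pa qa.
  apply: fm_eq0 => z; have /memv_imgP[b _ ->] : z \in limg p by rewrite p_full memvf.
  by rewrite fmpq qa fm0l.
have pK : cancel (p^-1)%VF p by move=> z; rewrite limg_lfunVK // p_full memvf.
have qK : cancel (q^-1)%VF q by move=> z; rewrite limg_lfunVK // q_full memvf.
have qVK a : (q^-1)%VF (q a) = a by rewrite lker0_lfunK.
have pVK a : (p^-1)%VF (p a) = a by rewrite lker0_lfunK.
pose f z := q ((p^-1)%VF z).
have f_linear : linear f by move=> c u v; rewrite /f !linearP.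
pose F0 := GRing.isLinear.Build K L M *:%R f f_linear.
pose f' : {linear L -> M} := HB.pack f F0.
exists f'; split => /=.
- by exists (fun z => p ((q^-1)%VF z)) => z; rewrite /f ?qVK ?pK // ?pVK qK.
- move=> u v; rewrite /f.
  set a := (p^-1)%VF u; set b := (p^-1)%VF v.
  have abG : [lie (vsval a : N), vsval b] \in G by rewrite brG ?subvsP.
  rewrite -[u]pK -[v]pK -/a -/b.
  have -> : [lie p a, p b] = p (vsproj G [lie (vsval a : N), vsval b]).
    by rewrite !pE vsprojK.
  by rewrite pVK !qE vsprojK.
- by move=> u v; rewrite /f -fmpq !pK.
Qed.

End DataIsometry.

Section FormMore.
Variables (K : fieldType) (L : quadLie K).
Implicit Types (x y z : L).

Lemma fm_cycle x y z : 'B(x, [lie y, z]) = 'B(z, [lie x, y]).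
Proof. by rewrite -fm_inv fmC. Qed.

Lemma fm_brl x y : 'B(x, [lie x, y]) = 0.
Proof. by rewrite -fm_inv brr fm0l. Qed.

Lemma fm_brr x y : 'B(x, [lie y, x]) = 0.
Proof. by rewrite fm_cycle fm_brl. Qed.

(** Turns identities between vectors into identities between scalars, where [ring] and [field]
    apply. *)
Lemma fm_inj x y : (forall z, 'B(x, z) = 'B(y, z)) -> x = y.
Proof.
by move=> H; apply/eqP; rewrite -subr_eq0; apply/eqP/fm_eq0 => z;
  rewrite fmDl fmNl H subrr.
Qed.

End FormMore.

Section SeqGenerators.
Variables (K : fieldType) (L : lieAlgebra K).

Definition gens d (s : seq L) : 'I_d -> L := fun i => s`_i.

Lemma spans1P x : spans (gens (d := 1) [:: x]) <->
  forall v, exists a, v - a *: x \in lower_central L 2.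
Proof.
split=> H v; have := H v; first by case=> c; rewrite big_ord1; exists (c 0).
by case=> a; exists (fun _ => a); rewrite big_ord1.
Qed.

Lemma spans2P x y : spans (gens (d := 2) [:: x; y]) <->
  forall v, exists a b, v - (a *: x + b *: y) \in lower_central L 2.
Proof.
split=> H v; have := H v.
  by case=> c; rewrite !big_ord_recl big_ord0 addr0 => ?; do 2 eexists; eassumption.
by case=> a [b ab]; exists (fun i => [:: a; b]`_i); rewrite !big_ord_recl big_ord0 addr0.
Qed.

Lemma spans3P x y z : spans (gens (d := 3) [:: x; y; z]) <->
  forall v, exists a b c, v - (a *: x + b *: y + c *: z) \in lower_central L 2.
Proof.
split=> H v; have := H v.
  case=> c; rewrite !big_ord_recl big_ord0 addr0 addrA => ?; do 3 eexists; eassumption.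
case=> a [b [c abc]]; exists (fun i => [:: a; b; c]`_i).
by rewrite !big_ord_recl big_ord0 addr0 addrA.
Qed.

End SeqGenerators.

(** * Reduction of the values on words to finitely many data *)

Lemma pair_ind2 (P : nat -> nat -> Prop) : (forall i, P i i) ->
  (forall i j, P i j -> P j i) -> P 0%N 1%N ->
  forall i j : 'I_2, P i j.
Proof.
move=> D S P01 [i i2] [j j2] /=.
by case: i j i2 j2 => [|[|i]] [|[|j]] // _ _; try exact: D; apply: S.
Qed.

(** For expressions antisymmetric in two generators; the three remaining pairs are in cyclic order,
    as in the brackets e0, e1, e2. *)
Lemma pair_ind3 (P : nat -> nat -> Prop) : (forall i, P i i) ->
  (forall i j, P i j -> P j i) -> P 1%N 2%N -> P 2%N 0%N -> P 0%N 1%N ->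
  forall i j : 'I_3, P i j.
Proof.
move=> D S P12 P20 P01 [i i3] [j j3] /=.
by case: i j i3 j3 => [|[|[|i]]] [|[|[|j]]] // _ _; try exact: D; apply: S.
Qed.

Section Data.
Variables (K : fieldType) (L M : quadLie K).
Implicit Types (x : L) (y : M).

Lemma word_perp N d (x : 'I_d -> L) i w k : lower_central L N = 0%VS ->
  (N <= (size w).+1)%N -> 'B(x i, word x w k) = 0.
Proof.
by move=> L0 Nw; apply: (lc_perp (i := 1) L0 _ (lc_full _ _) (word_lc x w k)).
Qed.
End Data.

Lemma word_gens1 (K : fieldType) (L : lieAlgebra K) (x : L) w k :
  word (gens (d := 1) [:: x]) w k = if w is [::] then x else 0.
Proof.
elim: w => [|j w IH]; first by rewrite !ord1.
rewrite (_ : word _ _ _ = [lie [:: x]`_j, word (gens (d := 1) [:: x]) w k]) //.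
by rewrite IH ord1; case: w {IH} => *; rewrite ?brr ?br0r.
Qed.

Lemma data1_isometric (K : fieldType) (L M : quadLie K) (x : L) (y : M) :
  lie_nilpotent L -> lie_nilpotent M ->
  spans (gens (d := 1) [:: x]) -> spans (gens (d := 1) [:: y]) ->
  'B(x, x) = 'B(y, y) -> isometric L M.
Proof.
move=> nL nM sx sy Gxy; apply: (data_isometric nL nM sx sy) => i w k.
by rewrite !word_gens1 !ord1; case: w => *; rewrite ?fm0r.
Qed.

(** By increasing length of [w], the value is an entry of the Gram matrix; 0, since a generator
    repeats in B(x_i, [x_j, x_k]); 0 or B(z, z) up to sign; 0, since B(z, [x_l, z]) = 0; 0 or an
    entry of S up to sign. Longer words lie in n^6 = 0. *)
Lemma data2_words (K : fieldType) (L M : quadLie K) (x0 x1 : L) (y0 y1 : M) :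
  lower_central L 6 = 0%VS -> lower_central M 6 = 0%VS ->
  let zx := [lie x0, x1] in let zy := [lie y0, y1] in
  'B(x0, x0) = 'B(y0, y0) -> 'B(x0, x1) = 'B(y0, y1) -> 'B(x1, x1) = 'B(y1, y1) ->
  'B(zx, zx) = 'B(zy, zy) ->
  'B([lie x0, zx], [lie x0, zx]) = 'B([lie y0, zy], [lie y0, zy]) ->
  'B([lie x0, zx], [lie x1, zx]) = 'B([lie y0, zy], [lie y1, zy]) ->
  'B([lie x1, zx], [lie x1, zx]) = 'B([lie y1, zy], [lie y1, zy]) ->
  let xs := [:: x0; x1] in let ys := [:: y0; y1] in
  forall (i : 'I_2) w k,
    'B(xs`_i, word (gens (d := 2) xs) w k) = 'B(ys`_i, word (gens (d := 2) ys) w k).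
Proof.
move=> L0 M0 zx zy G00 G01 G11 beta S00 S01 S11 xs ys i w k.
case: w => [|j [|l [|m [|n [|? ?]]]]]; last by rewrite !(@word_perp _ _ 6 _ (gens _)).
- rewrite /= /gens; case: i => [[|[|]] ?] //=; case: k => [[|[|]] ?] //=.
  by rewrite (fmC x1) (fmC y1).
- rewrite /= /gens; move: j k.
  apply: (pair_ind2 (P := fun j k =>
    'B(xs`_i, [lie xs`_j, xs`_k]) = 'B(ys`_i, [lie ys`_j, ys`_k]))).
  + by move=> j; rewrite !brr !fm0r.
  + by move=> j k E; rewrite brC fmNr E -fmNr -brC.
  + by case: i => [[|[|]] ?] //=; rewrite ?fm_brl ?fm_brr.
- rewrite /= /gens -(fm_inv xs`_i) -(fm_inv ys`_i); move: i j.
  apply: (pair_ind2 (P := fun i j =>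
    'B([lie xs`_i, xs`_j], [lie xs`_l, xs`_k])
      = 'B([lie ys`_i, ys`_j], [lie ys`_l, ys`_k]))).
  + by move=> j; rewrite !brr !fm0l.
  + by move=> i j E; rewrite brC fmNl E -fmNl -brC.
  move: l k; apply: (pair_ind2 (P := fun l k =>
    'B(zx, [lie xs`_l, xs`_k]) = 'B(zy, [lie ys`_l, ys`_k]))) => //.
  + by move=> j; rewrite !brr !fm0r.
  + by move=> j k E; rewrite brC fmNr E -fmNr -brC.
- rewrite /= /gens -(fm_inv xs`_i) -(fm_inv ys`_i); move: i j.
  apply: (pair_ind2 (P := fun i j =>
    'B([lie xs`_i, xs`_j], [lie xs`_l, [lie xs`_m, xs`_k]])
      = 'B([lie ys`_i, ys`_j], [lie ys`_l, [lie ys`_m, ys`_k]]))).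
  + by move=> j; rewrite !brr !fm0l.
  + by move=> i j E; rewrite brC fmNl E -fmNl -brC.
  move: m k; apply: (pair_ind2 (P := fun m k =>
    'B(zx, [lie xs`_l, [lie xs`_m, xs`_k]])
      = 'B(zy, [lie ys`_l, [lie ys`_m, ys`_k]]))) => //.
  + by move=> j; rewrite !brr !br0r !fm0r.
  + by move=> m' k' E; rewrite (brC xs`_k') (brC ys`_k') !brNr !fmNr E.
  + by rewrite -/zx -/zy !fm_brr.
- rewrite /= /gens -(fm_inv xs`_i) -(fm_inv ys`_i); move: i j.
  apply: (pair_ind2 (P := fun i j =>
    'B([lie xs`_i, xs`_j], [lie xs`_l, [lie xs`_m, [lie xs`_n, xs`_k]]])
      = 'B([lie ys`_i, ys`_j], [lie ys`_l, [lie ys`_m, [lie ys`_n, ys`_k]]]))).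
  + by move=> j; rewrite !brr !fm0l.
  + by move=> i j E; rewrite brC fmNl E -fmNl -brC.
  move: n k; apply: (pair_ind2 (P := fun n k =>
    'B(zx, [lie xs`_l, [lie xs`_m, [lie xs`_n, xs`_k]]])
      = 'B(zy, [lie ys`_l, [lie ys`_m, [lie ys`_n, ys`_k]]]))) => //.
  + by move=> j; rewrite !brr !br0r !fm0r.
  + by move=> n' k' E; rewrite (brC xs`_k') (brC ys`_k') !brNr !fmNr E.
  rewrite /= -/zx -/zy -[LHS]opprK -[RHS]opprK -(fm_adj xs`_l) -(fm_adj ys`_l).
  case: l => [[|[|]] ?] //=; case: m => [[|[|]] ?] //=; rewrite ?S00 ?S01 ?S11 //.
  by rewrite (fmC [lie x1, zx]) (fmC [lie y1, zy]) S01.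
Qed.

(** The pattern of [data2_words], except that B(x_i, [x_j, x_k]) with three distinct indices is
    B(x_0, e0) up to sign, by cyclic invariance, and that words already vanish in n^4. *)
Lemma data3_words (K : fieldType) (L M : quadLie K)
    (x0 x1 x2 : L) (y0 y1 y2 : M) :
  lower_central L 4 = 0%VS -> lower_central M 4 = 0%VS ->
  let e0 := [lie x1, x2] in let e1 := [lie x2, x0] in let e2 := [lie x0, x1] in
  let f0 := [lie y1, y2] in let f1 := [lie y2, y0] in let f2 := [lie y0, y1] in
  'B(x0, x0) = 'B(y0, y0) -> 'B(x0, x1) = 'B(y0, y1) -> 'B(x0, x2) = 'B(y0, y2) ->
  'B(x1, x1) = 'B(y1, y1) -> 'B(x1, x2) = 'B(y1, y2) -> 'B(x2, x2) = 'B(y2, y2) ->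
  'B(x0, e0) = 'B(y0, f0) ->
  'B(e0, e0) = 'B(f0, f0) -> 'B(e0, e1) = 'B(f0, f1) -> 'B(e0, e2) = 'B(f0, f2) ->
  'B(e1, e1) = 'B(f1, f1) -> 'B(e1, e2) = 'B(f1, f2) -> 'B(e2, e2) = 'B(f2, f2) ->
  let xs := [:: x0; x1; x2] in let ys := [:: y0; y1; y2] in
  forall (i : 'I_3) w k,
    'B(xs`_i, word (gens (d := 3) xs) w k) = 'B(ys`_i, word (gens (d := 3) ys) w k).
Proof.
move=> L0 M0 e0 e1 e2 f0 f1 f2 G00 G01 G02 G11 G12 G22 tau
  E00 E01 E02 E11 E12 E22 xs ys i w k.
have [G10 G20 G21] : [/\ 'B(x1, x0) = 'B(y1, y0), 'B(x2, x0) = 'B(y2, y0)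
    & 'B(x2, x1) = 'B(y2, y1)].
  by rewrite !(fmC x2) !(fmC y2) (fmC x1) (fmC y1).
have [E10 E20 E21] : [/\ 'B(e1, e0) = 'B(f1, f0), 'B(e2, e0) = 'B(f2, f0)
    & 'B(e2, e1) = 'B(f2, f1)].
  by rewrite !(fmC e2) !(fmC f2) (fmC e1) (fmC f1).
case: w => [|j [|l [|? ?]]]; last by rewrite !(@word_perp _ _ 4 _ (gens _)).
- by rewrite /= /gens; case: i => [[|[|[|]]] ?] //; case: k => [[|[|[|]]] ?].
- rewrite /= /gens; move: j k.
  apply: (pair_ind3 (P := fun j k =>
    'B(xs`_i, [lie xs`_j, xs`_k]) = 'B(ys`_i, [lie ys`_j, ys`_k]))).
  + by move=> j; rewrite !brr !fm0r.
  + by move=> j k E; rewrite brC fmNr E -fmNr -brC.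
  + by case: i => [[|[|[|]]] ?] //=; rewrite ?fm_brl ?fm_brr.
  + case: i => [[|[|[|]]] ?] //=; rewrite ?fm_brl ?fm_brr //.
    by rewrite fm_cycle tau -fm_cycle.
  + case: i => [[|[|[|]]] ?] //=; rewrite ?fm_brl ?fm_brr //.
    by rewrite -fm_cycle tau fm_cycle.
- rewrite /= /gens -(fm_inv xs`_i) -(fm_inv ys`_i); move: i j.
  apply: (pair_ind3 (P := fun i j =>
    'B([lie xs`_i, xs`_j], [lie xs`_l, xs`_k])
      = 'B([lie ys`_i, ys`_j], [lie ys`_l, ys`_k]))).
  + by move=> j; rewrite !brr !fm0l.
  + by move=> i j E; rewrite brC fmNl E -fmNl -brC.
  + move: l k; apply: (pair_ind3 (P := fun l k =>
      'B(e0, [lie xs`_l, xs`_k]) = 'B(f0, [lie ys`_l, ys`_k]))) => //.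
    * by move=> j; rewrite !brr !fm0r.
    * by move=> j k E; rewrite brC fmNr E -fmNr -brC.
  + move: l k; apply: (pair_ind3 (P := fun l k =>
      'B(e1, [lie xs`_l, xs`_k]) = 'B(f1, [lie ys`_l, ys`_k]))) => //.
    * by move=> j; rewrite !brr !fm0r.
    * by move=> j k E; rewrite brC fmNr E -fmNr -brC.
  + move: l k; apply: (pair_ind3 (P := fun l k =>
      'B(e2, [lie xs`_l, xs`_k]) = 'B(f2, [lie ys`_l, ys`_k]))) => //.
    * by move=> j; rewrite !brr !fm0r.
    * by move=> j k E; rewrite brC fmNr E -fmNr -brC.
Qed.

(** * Generators modulo the derived algebra *)

Section Generators.
Variables (K : fieldType) (L : lieAlgebra K).
Local Notation lc := (lower_central L).

Lemma tuple_famE d (x : 'I_d -> L) (i : 'I_d) : [tuple x i | i < d]`_i = x i.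
Proof. by rewrite -tnth_nth tnth_mktuple. Qed.

Lemma spansP d (x : 'I_d -> L) :
  spans x <-> forall v, v \in (<<[tuple x i | i < d]>> + lc 2)%VS.
Proof.
split=> H v; have := H v.
  case=> c cv; rewrite -(subrK (\sum_i c i *: x i) v) addrC memv_add //.
  apply: memv_suml => i _; rewrite memvZ // memv_span // -tuple_famE.
  by rewrite mem_nth ?size_tuple.
case/memv_addP => u uX [w w2 ->]; exists (fun i => coord [tuple x i | i < d] i u).
rewrite {1}(coord_span uX) addrC addrA (eq_bigr _ (fun i _ => congr1 _ (tuple_famE x i))).
by rewrite addNr add0r.
Qed.

Lemma spans_sub d d' (x : 'I_d -> L) (x' : 'I_d' -> L) : spans x ->
  (forall i, exists c : 'I_d' -> K, x i - \sum_j c j *: x' j \in lc 2) -> spans x'.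
Proof.
rewrite !spansP => sx xx' v; apply: subvP (sx v); rewrite subv_add addvSr andbT.
apply/span_subvP => _ /mapP[i _ ->]; have [c ci] := xx' i.
rewrite -(subrK (\sum_j c j *: x' j) (x i)) addrC memv_add //.
apply: memv_suml => j _; rewrite memvZ // memv_span // -tuple_famE.
by rewrite mem_nth ?size_tuple.
Qed.

Lemma eq_spans d (x x' : 'I_d -> L) : (forall i, x i = x' i) -> spans x -> spans x'.
Proof.
by move=> xx sx v; have [c cv] := sx v; exists c; under eq_bigr do rewrite -xx.
Qed.

Lemma spans_perturb d (x x' : 'I_d -> L) : spans x ->
  (forall i, x' i - x i \in lc 2) -> spans x'.
Proof.
move=> sx xx'; apply: spans_sub sx _ => i; exists (fun j => (j == i)%:R).
rewrite (bigD1 i) //= eqxx scale1r big1 ?addr0 -?[x i - _]opprB ?memvN //.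
by move=> j /negPf->; rewrite scale0r.
Qed.

Lemma spans_mx d (x : 'I_d -> L) (g : 'M[K]_d) : spans x -> g \in unitmx ->
  spans (fun i => \sum_j g i j *: x j).
Proof.
move=> sx gu; apply: spans_sub sx _ => i; exists (invmx g i).
suff -> : \sum_j invmx g i j *: (\sum_k g j k *: x k) = x i by rewrite subrr mem0v.
have gE k : \sum_j invmx g i j * g j k = (i == k)%:R.
  by have := congr1 (fun h : 'M_d => h i k) (mulVmx gu); rewrite !mxE.
under eq_bigr do rewrite scaler_sumr; rewrite exchange_big /=.
rewrite (eq_bigr (fun k => (i == k)%:R *: x k)) => [|k _].
  by rewrite (bigD1 i) //= eqxx scale1r big1 ?addr0 // => k /negPf; rewrite eq_sym => ->;
    rewrite scale0r.
by rewrite -gE scaler_suml; apply: eq_bigr => j _; rewrite scalerA.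
Qed.

Lemma spans_exist d : lie_type L = d -> exists x : 'I_d -> L, spans x.
Proof.
move=> <-; rewrite /lie_type -dimv_compl.
exists (fun i => (vbasis (lc 2)^C)`_i) => v.
have : v \in (lc 2 + (lc 2)^C)%VS by rewrite addv_complf memvf.
case/memv_addP => w w2 [u uC ->].
exists (fun i => coord (vbasis (lc 2)^C) i u).
by rewrite -coord_vbasis // addrK.
Qed.

Lemma type_indep d (x : 'I_d -> L) : spans x ->
  (forall c : 'I_d -> K, \sum_i c i *: x i \in lc 2 -> forall i, c i = 0) ->
  lie_type L = d.
Proof.
move=> sx ix; pose X := [tuple x i | i < d].
have xX (i : 'I_d) : X`_i = x i by rewrite tuple_famE.
have XF : free X.
  apply/freeP => c c0; apply: ix; under eq_bigr do rewrite -xX.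
  by rewrite c0 mem0v.
have XC : (<<X>> :&: lc 2 = 0)%VS.
  apply/eqP; rewrite -subv0; apply/subvP => v; rewrite memv_cap memv0.
  case/andP=> /coord_span-> vL; apply/eqP/big1 => i _.
  rewrite (ix (fun i => coord X i v)) ?scale0r //.
  by under eq_bigr do rewrite -xX.
rewrite /lie_type; have -> : {:L}%VS = (<<X>> + lc 2)%VS.
  apply/eqP; rewrite eqEsubv subvf andbT; apply/subvP => v _.
  exact: (spansP x).1.
by rewrite dimv_disjoint_sum // (eqP XF) size_tuple addnK.
Qed.

End Generators.

(** * Dual vectors and removal of the Gram matrix *)

Section Representation.
Variables (K : fieldType) (L : quadLie K).
Implicit Types (U V W : {vspace L}).
Local Notation lc := (lower_central L).
Local Notation orth := (orthov (quad_form L)).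

(** The orthogonal of U contains the kernel of a linear map to a space of dimension dim U. *)
Lemma dim_orthov U : (\dim {:L} <= \dim U + \dim (orth U))%N.
Proof.
pose f (v : L) : 'rV[K]_(\dim U) := \row_i 'B(v, (vbasis U)`_i).
have f_lin : linear f.
  by move=> a u v; apply/rowP => i; rewrite !mxE fmDl fmZl.
pose F0 := GRing.isLinear.Build K L _ *:%R f f_lin.
pose F : {linear L -> 'rV[K]_(\dim U)} := HB.pack f F0.
rewrite -(limg_ker_dim (linfun F) fullv) capfv addnC leq_add //.
  by apply: leq_trans (dimvS (subvf _)) _; rewrite dimvf /dim /= mul1n.
apply/dimvS/subvP => v; rewrite memv_ker lfunE => /eqP /rowP fv.
apply/mem_orthovP => u /coord_vbasis->; rewrite fm_sumr big1 // => i _.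
by have := fv i; rewrite !mxE fmZr => ->; rewrite mulr0.
Qed.

(** The other generators and n^2 span a proper subspace, by dimension count, so some nonzero [z] is
    orthogonal to it; nondegeneracy makes B(z, x_i) nonzero, and [z] is rescaled. By [central_orth]
    such a vector is central. *)
Lemma spans_dual d (x : 'I_d -> L) i : spans x -> lie_type L = d ->
  exists z, (forall j, 'B(z, x j) = (i == j)%:R) /\ (forall u, u \in lc 2 -> 'B(z, u) = 0).
Proof.
move=> sx td; pose U := (\sum_(j < d | j != i) <[x j]> + lc 2)%VS.
have dimU : (\dim U < \dim {:L})%N.
  have d_pos : (0 < d)%N by apply: leq_ltn_trans (ltn_ord i).
  have : (\dim U <= d.-1 + \dim (lc 2))%N.
    apply: leq_trans (dimv_add_leqif _ _) _; rewrite leq_add2r.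
    apply: leq_trans (dimv_leq_sum _ _ _) _.
    apply: (@leq_trans (\sum_(j < d | j != i) 1)%N).
      by apply: leq_sum => j _; rewrite dim_vline leq_b1.
    by rewrite sum1_card cardC1 card_ord.
  move: td; rewrite /lie_type; lia.
have : orth U != 0%VS.
  by rewrite -dimv_eq0; have := dim_orthov U; lia.
rewrite -vpick0; set z := vpick _ => z0.
have /mem_orthovP zU : z \in orth U by apply: memv_pick.
have z2 u : u \in lc 2 -> 'B(z, u) = 0 by move=> u2; apply/zU/(subvP (addvSr _ _)).
have zx j : j != i -> 'B(z, x j) = 0.
  move=> ji; apply/zU/(subvP (addvSl _ _)); rewrite memvE.
  by apply: (sumv_sup j).
have zi : 'B(z, x i) != 0.
  apply: contraNneq z0 => zi; apply/eqP/fm_eq0 => v; have [c cv] := sx v.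
  rewrite -(subrK (\sum_i c i *: x i) v) fmDr z2 // add0r fm_sumr big1 // => j _.
  by rewrite fmZr; have [->|/zx->] := eqVneq j i; rewrite ?zi mulr0.
exists ('B(z, x i)^-1 *: z); split=> [j|u u2]; rewrite fmZl; last by rewrite (z2 _ u2) mulr0.
by rewrite eq_sym; have [->|/zx->] := eqVneq j i; rewrite ?mulVf ?mulr0.
Qed.

Lemma spans_indep d (x : 'I_d -> L) (c : 'I_d -> K) : spans x -> lie_type L = d ->
  \sum_i c i *: x i \in lc 2 -> forall i, c i = 0.
Proof.
move=> sx td c2 i; have [z [zx z2]] := spans_dual i sx td.
rewrite -(z2 _ c2) fm_sumr (bigD1 i) //= big1 => [|j ji].
  by rewrite fmZr zx eqxx mulr1 addr0.
by rewrite fmZr zx eq_sym (negPf ji) mulr0.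
Qed.

End Representation.

Lemma nondegenerate_line (K : fieldType) (L : quadLie K) (u : L) :
  (forall y, [lie u, y] = 0) -> 'B(u, u) != 0 -> (1 < \dim {:L})%N -> decomposable L.
Proof.
move=> uC uu dL; have u0 : u != 0 by apply: contraNneq uu => ->; rewrite fm0l.
exists <[u]>%VS; split.
- by move=> _ y /vlineP[a ->]; rewrite brZl uC scaler0 mem0v.
- by move/eqP; rewrite -dimv_eq0 dim_vline u0.
- by move=> uL; move: dL; rewrite -uL dim_vline u0.
- apply/eqP; rewrite -subv0; apply/subvP => v; rewrite memv_cap => /andP[/vlineP[a ->]].
  rewrite mem_orthov1 fmZl mulf_eq0 (negPf uu) orbF => /eqP->.
  by rewrite scale0r mem0v.
Qed.

Section Indecomposable.
Variables (K : fieldType) (L : quadLie K).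
Hypotheses (two : (2%:R : K) != 0) (iL : indecomposable L).
Local Notation lc := (lower_central L).

Lemma central_isotropic (u v : L) : (1 < \dim {:L})%N ->
  (forall y, [lie u, y] = 0) -> (forall y, [lie v, y] = 0) -> 'B(u, v) = 0.
Proof.
move=> dL uC vC.
have iso (w : L) : (forall y, [lie w, y] = 0) -> 'B(w, w) = 0.
  by move=> wC; apply/eqP/negPn/negP => ww; exact: (iL (nondegenerate_line wC ww dL)).
have : 'B(u + v, u + v) = 0 by apply: iso => y; rewrite brDl uC vC addr0.
rewrite fmDl !fmDr !iso // (fmC v u) add0r addr0 -mulr2n -mulr_natl => /eqP.
by rewrite mulf_eq0 (negPf two) => /eqP.
Qed.

(* Half the Gram matrix is absorbed by central elements dual to the generators; these
   are isotropic, hence lie in [L, L]. *)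
Lemma kill_gram d (x : 'I_d -> L) : (1 < d)%N -> lie_type L = d -> spans x ->
  exists z : 'I_d -> L, let x' i := x i + z i in
    [/\ spans x', forall i j, 'B(x' i, x' j) = 0 &
        forall i y, [lie x' i, y] = [lie x i, y]].
Proof.
move=> d1 td sx.
have dL : (1 < \dim {:L})%N.
  by apply: leq_trans d1 _; rewrite -td leq_subr.
have /fin_all_exists[z zP] := fun i => spans_dual i sx td.
have zx i j : 'B(z i, x j) = (i == j)%:R by case: (zP i).
have zL i u : u \in lc 2 -> 'B(z i, u) = 0 by case: (zP i) => _; apply.
have zC i : forall y, [lie z i, y] = 0 by apply/central_orth/zL.
have zz i j : 'B(z i, z j) = 0 by apply: central_isotropic.
(* The coefficients of [z i] modulo n^2 are its products with the dual vectors [z j], which vanish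
   by isotropy. *)
have z2 i : z i \in lc 2.
  have [c ci] := sx (z i); suff c0 j : c j = 0.
    by move: ci; rewrite big1 ?subr0 // => j _; rewrite c0 scale0r.
  have := zL j _ ci; rewrite fmDr fmNr zz sub0r fm_sumr (bigD1 j) //= big1.
    by rewrite fmZr zx eqxx mulr1 addr0 => /eqP; rewrite oppr_eq0 => /eqP.
  by move=> k kj; rewrite fmZr zx eq_sym (negPf kj) mulr0.
(* The two cross terms of B(x_i + w_i, x_j + w_j) each contribute minus half of B(x_i, x_j), and
   B(w_i, w_j) = 0. *)
pose w i := \sum_j (- 2%:R^-1 * 'B(x i, x j)) *: z j.
have w2 i : w i \in lc 2 by apply: memv_suml => j _; rewrite memvZ.
have wx i k : 'B(w i, x k) = - 2%:R^-1 * 'B(x i, x k).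
  rewrite fm_suml (bigD1 k) //= big1 => [|j jk]; rewrite fmZl zx ?eqxx ?mulr1 ?addr0 //.
  by rewrite (negPf jk) mulr0.
exists w; split=> [|i j|i y].
- by apply: spans_perturb sx _ => i; rewrite addrC addKr.
- have ww : 'B(w i, w j) = 0.
    rewrite fm_suml big1 // => k _; rewrite fmZl fm_sumr big1 ?mulr0 // => l _.
    by rewrite fmZr zz mulr0.
  by rewrite fmDl !fmDr ww (fmC (x i) (w j)) !wx (fmC (x j)); field.
- rewrite brDl br_suml big1 ?addr0 // => j _; by rewrite brZl zC scaler0.
Qed.

End Indecomposable.

Lemma natr_neq0 (K : fieldType) : [pchar K] =i pred0 -> forall n, (n.+1%:R : K) != 0.
Proof. by move=> /pcharf0P cK n; rewrite cK. Qed.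

(** * Decompositions *)

Section Decomposable.
Variables (K : fieldType) (L : lieAlgebra K).
Implicit Types (U V W : {vspace L}).
Hypothesis nL : lie_nilpotent L.
Local Notation lc := (lower_central L).

(** Such a V lies in every term of the lower central series. *)
Lemma nilpotent_fix V : (V <= lie_prodv V fullv)%VS -> V = 0%VS.
Proof.
move=> VV; have VL k : (V <= lc k.+1)%VS.
  elim: k => [|k IH]; first exact: subvf.
  apply: subv_trans VV _; apply/lie_prodvP => x y xV _.
  by apply/lcSl/(subvP IH).
by case: nL => N LN; apply/eqP; rewrite -subv0 -LN.
Qed.

Lemma ideal_square U : lie_ideal U -> (lie_prodv U U <= U)%VS.
Proof. by move=> UI; apply/lie_prodvP => x y xU _; apply: UI. Qed.

Lemma ideal_square_lt U : lie_ideal U -> U <> 0%VS ->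
  (\dim (lie_prodv U U) < \dim U)%N.
Proof.
move=> UI U0; have UU := ideal_square UI.
rewrite ltn_neqAle dimvS // andbT (dimv_leqif_eq UU); apply/negP => /eqP E.
apply: U0; apply: nilpotent_fix; rewrite -{1}E; apply/lie_prodvP => x y xU _.
have /lie_prodvP := subvv (lie_prodv U fullv); apply=> //; exact: memvf.
Qed.

(** If U is spanned by [u] and U^2, then, as [[u, u] = 0], every bracket in U has a factor in U^2.
    Hence U^2 lies in [U^2, L] and vanishes by [nilpotent_fix]. *)
Lemma ideal_line U : lie_ideal U -> (\dim U <= (\dim (lie_prodv U U)).+1)%N ->
  lie_prodv U U = 0%VS.
Proof.
move=> UI dU; have UU := ideal_square UI; set U2 := lie_prodv U U.
have [E|] := eqVneq U2 U.
  apply: nilpotent_fix; apply/lie_prodvP => x y xU _.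
  have /lie_prodvP := subvv (lie_prodv U2 fullv); apply=> //; last exact: memvf.
  by rewrite E.
rewrite eqEsubv UU /= => /subvPn[u uU uU2].
have u0 : u != 0 by apply: contraNneq uU2 => ->; rewrite mem0v.
have UE : (U <= <[u]> + U2)%VS.
  have : (<[u]> + U2 <= U)%VS by rewrite subv_add -memvE uU.
  move/dimv_leqif_sup => [_ <-]; rewrite eqn_leq; apply/andP; split.
    by apply: dimvS; rewrite subv_add -memvE uU.
  apply: leq_trans dU _; rewrite dimv_disjoint_sum; last first.
    apply/eqP; rewrite -subv0; apply/subvP => v; rewrite memv_cap => /andP[/vlineP[a ->]].
    have [->|a0] := eqVneq a 0; first by rewrite scale0r !mem0v.
    by move/(memvZ a^-1); rewrite scalerA mulVf // scale1r (negPf uU2).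
  by rewrite dim_vline u0.
apply: nilpotent_fix; apply/lie_prodvP => x y /(subvP UE) /memv_addP[_ /vlineP[a ->] [v vU ->]].
move=> /(subvP UE) /memv_addP[_ /vlineP[b ->] [w wU ->]].
have /lie_prodvP P := subvv (lie_prodv U2 fullv).
rewrite brDl brZl !brDr brZr brr scaler0 add0r memvD ?memvZ //.
  by rewrite brC memvN; apply: P => //; apply: memvf.
by rewrite -brDr P // memvf.
Qed.

End Decomposable.

Section Splitting.
Variables (K : fieldType) (L : quadLie K).
Implicit Types (U V W : {vspace L}).
Hypothesis nL : lie_nilpotent L.
Local Notation lc := (lower_central L).

Lemma decomposable_split : decomposable L -> exists U W,
  [/\ lie_ideal U /\ lie_ideal W, U <> 0%VS /\ W <> 0%VS, (U + W)%VS = fullv,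
      (U :&: W)%VS = 0%VS & forall u w, u \in U -> w \in W -> 'B(u, w) = 0].
Proof.
case=> U [UI U0 UL UN]; exists U, (orthov (quad_form L) U).
have dUW : (\dim {:L} <= \dim (U + orthov (quad_form L) U))%N.
  by rewrite dimv_disjoint_sum // dim_orthov.
have orthU u w : u \in U -> w \in orthov (quad_form L) U -> 'B(u, w) = 0.
  by move=> uU /mem_orthovP wU; rewrite fmC wU.
split=> //.
- split=> // w y /mem_orthovP wU; apply/mem_orthovP => u uU.
  by rewrite fm_inv wU // brC memvN UI.
- split=> // W0; apply: UL; apply/eqP; rewrite eqEdim subvf /=.
  by move: dUW; rewrite W0 addv0.
- by apply/eqP; rewrite eqEdim subvf.
Qed.

(** As n^2 lies in U^2 + W^2, the dimensions of U/U^2 and W/W^2, both positive, add up to at most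
    the type. Type 2 leaves 1 for each of them, type 3 leaves 1 for at least one. *)
Lemma decomposable_central : decomposable L ->
  ((lie_type L <= 2)%N -> lie_abelian L) /\
  ((lie_type L <= 3)%N -> exists2 u : L, forall y, [lie u, y] = 0 & 'B(u, u) != 0).
Proof.
case/decomposable_split=> U [W [[UI WI] [U0 W0] UW UW0 BUW]].
have cross u w : u \in U -> w \in W -> [lie u, w] = 0.
  move=> uU wW; apply/eqP; rewrite -memv0 -UW0 memv_cap UI //=.
  by rewrite brC memvN WI.
have dec x : exists2 u, u \in U & exists2 w, w \in W & x = u + w.
  have : x \in (U + W)%VS by rewrite UW memvf.
  by case/memv_addP => u uU [w wW ->]; exists u => //; exists w.
have L2 : (lc 2 <= lie_prodv U U + lie_prodv W W)%VS.
  apply: lc_ind => x y _; have [u uU [w wW ->]] := dec x.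
  have [u' uU' [w' wW' ->]] := dec y.
  rewrite brDl !brDr (cross u w') // (brC w u') (cross u' w) // oppr0 addr0 add0r.
  have /lie_prodvP PU := subvv (lie_prodv U U).
  have /lie_prodvP PW := subvv (lie_prodv W W).
  by rewrite memv_add ?PU ?PW.
have dU := ideal_square_lt nL UI U0; have dW := ideal_square_lt nL WI W0.
have dL2 := leq_trans (dimvS L2) (dimv_add_leqif _ _).
have dL : \dim {:L} = (\dim U + \dim W)%N by rewrite -UW dimv_disjoint_sum.
(* A summand with dim V/V^2 at most 1 is a line spanned by a central vector. Being orthogonal to the
   other summand, this vector cannot be isotropic, by nondegeneracy. *)
have linear_part V V' : lie_ideal V -> V <> 0%VS -> (V + V')%VS = fullv ->
    (forall v w, v \in V -> w \in V' -> [lie v, w] = 0) ->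
    (forall v w, v \in V -> w \in V' -> 'B(v, w) = 0) ->
    (\dim V <= (\dim (lie_prodv V V)).+1)%N ->
    exists2 u : L, forall y, [lie u, y] = 0 & 'B(u, u) != 0.
  move=> VI V0 VV' cV BV dV; have V2 := ideal_line nL VI dV.
  exists (vpick V).
    move=> y; have : y \in (V + V')%VS by rewrite VV' memvf.
    case/memv_addP => v vV [w wV ->]; rewrite brDr (cV _ w) ?memv_pick // addr0.
    apply/eqP; rewrite -memv0 -V2.
    by have /lie_prodvP P := subvv (lie_prodv V V); rewrite P // memv_pick.
  have u0 : vpick V != 0 by rewrite vpick0; apply/eqP.
  apply: contraNneq (u0) => uu; apply/eqP/fm_eq0 => y.
  have : y \in (V + V')%VS by rewrite VV' memvf.
  case/memv_addP => v vV [w wV ->]; rewrite fmDr (BV _ w) ?memv_pick // addr0.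
  have : v \in <[vpick V]>%VS.
    suff -> : <[vpick V]>%VS = V by [].
    apply/eqP; rewrite eqEdim -memvE memv_pick dim_vline u0.
    by rewrite V2 dimv0 in dV.
  by case/vlineP => a ->; rewrite fmZr uu mulr0.
split=> tL.
  have U2 : lie_prodv U U = 0%VS by apply: (ideal_line nL UI); move: tL; rewrite /lie_type; lia.
  have W2 : lie_prodv W W = 0%VS by apply: (ideal_line nL WI); move: tL; rewrite /lie_type; lia.
  move=> x y; apply/eqP; rewrite -memv0.
  have -> : 0%VS = (lie_prodv U U + lie_prodv W W)%VS by rewrite U2 W2 addv0.
  by apply: subvP L2 _ _; apply/lcSl/memvf.
have [dU1|dU1] := leqP (\dim U) (\dim (lie_prodv U U)).+1.
  exact: (linear_part U W).
apply: (linear_part W U) => //; first by rewrite addvC.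
- by move=> w u wW uU; rewrite brC cross // oppr0.
- by move=> w u wW uU; rewrite fmC BUW.
- by move: tL; rewrite /lie_type; lia.
Qed.

End Splitting.

(** * Changes of generators *)

Definition brE := (brDl, brDr, brZl, brZr, brNl, brNr, br0l, br0r, brr).
Definition fmE := (fmDl, fmDr, fmZl, fmZr, fmNl, fmNr, fm0l, fm0r).

Section Changes.
Variables (K : fieldType) (L : quadLie K).
Implicit Types (x y z u v : L).
Local Notation lc := (lower_central L).

Lemma spans2_change x0 x1 (a b c d : K) : det2 a b c d != 0 ->
  spans (gens (d := 2) [:: x0; x1]) ->
  spans (gens (d := 2) [:: a *: x0 + b *: x1; c *: x0 + d *: x1]).
Proof.
move=> D0 /spans_sub; apply=> i.
pose D := det2 a b c d.
(* The rows of the inverse of the 2 by 2 matrix of the change. *)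
exists (fun j => (nth [::] [:: [:: d / D; - b / D]; [:: - c / D; a / D]] i)`_j).
rewrite !big_ord_recl big_ord0 /gens /=.
rewrite [X in X \in _](_ : _ = 0) ?mem0v //.
by apply: fm_inj => y; case: i => [[|[|i]] ?] //=; rewrite !fmE /D /det2 in D0 *; field.
Qed.

Lemma spans2_perturb x0 x1 x0' x1' : spans (gens (d := 2) [:: x0; x1]) ->
  x0' - x0 \in lc 2 -> x1' - x1 \in lc 2 -> spans (gens (d := 2) [:: x0'; x1']).
Proof.
by move=> sx d0 d1; apply: spans_perturb sx _ => -[[|[|i]] ?].
Qed.

Lemma spans3_perturb x0 x1 x2 x0' x1' x2' : spans (gens (d := 3) [:: x0; x1; x2]) ->
  x0' - x0 \in lc 2 -> x1' - x1 \in lc 2 -> x2' - x2 \in lc 2 ->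
  spans (gens (d := 3) [:: x0'; x1'; x2']).
Proof.
by move=> sx d0 d1 d2; apply: spans_perturb sx _ => -[[|[|[|i]]] ?].
Qed.

(** A vector orthogonal to all words is 0, but generators are independent modulo n^2 when their
    number is the type. This rules out the degenerate values of the data. *)
Lemma gen_neq0 d (x : 'I_d -> L) i : lie_nilpotent L -> spans x -> lie_type L = d ->
  ~ forall w k, 'B(x i, word x w k) = 0.
Proof.
move=> nL sx td xw.
have x0 : x i = 0.
  apply: fm_eq0 => y; apply/eqP; rewrite fmC -mem_orthov1.
  rewrite (words_full nL sx (U := orthov (quad_form L) <[x i]>)) ?memvf //.
  by move=> w k; rewrite mem_orthov1 fmC xw.
have := spans_indep (c := fun j => (j == i)%:R) sx td _ i.
rewrite eqxx big1 ?mem0v => [/(_ isT)/eqP|j _]; first by rewrite oner_eq0.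
by have [->|_] := eqVneq j i; rewrite ?x0 ?scaler0 ?scale0r.
Qed.

End Changes.

(** * Type 2 *)

Section TypeTwo.
Variables (K : closedFieldType) (L : quadLie K).
Hypotheses (two : (2%:R : K) != 0).
Hypotheses (L6 : lower_central L 6 = 0%VS).
Local Notation lc := (lower_central L).

Definition data2 (x0 x1 : L) (b s00 s01 s11 : K) :=
  let z := [lie x0, x1] in
  [/\ 'B(z, z) = b, 'B([lie x0, z], [lie x0, z]) = s00,
      'B([lie x0, z], [lie x1, z]) = s01 & 'B([lie x1, z], [lie x1, z]) = s11].

(** The bracket of the new generators is [D *: z], whence the factors [D ^+ 2]. *)
Lemma data2_change x0 x1 (b p q r a0 a1 c0 c1 : K) (D := det2 a0 a1 c0 c1) :
  let s i j k l := i * k * p + (i * l + j * k) * q + j * l * r in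
  data2 x0 x1 b p q r ->
  data2 (a0 *: x0 + a1 *: x1) (c0 *: x0 + c1 *: x1) (D ^+ 2 * b)
    (D ^+ 2 * s a0 a1 a0 a1) (D ^+ 2 * s a0 a1 c0 c1) (D ^+ 2 * s c0 c1 c0 c1).
Proof.
move=> s [zz p_ q_ r_]; rewrite /data2; set z := [lie x0, x1] in zz p_ q_ r_ *.
have -> : [lie a0 *: x0 + a1 *: x1, c0 *: x0 + c1 *: x1] = D *: z.
  by apply: fm_inj => y; rewrite !brE (brC x1 x0) -/z !fmE /D /det2; ring.
have q_' : 'B([lie x1, z], [lie x0, z]) = q by rewrite fmC.
by split; rewrite ?brE ?fmE ?zz ?p_ ?q_ ?q_' ?r_ /s; ring.
Qed.

Lemma normal_data2 (x0 x1 : L) : spans (gens (d := 2) [:: x0; x1]) ->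
  exists y0 y1 : L, spans (gens (d := 2) [:: y0; y1]) /\
  [\/ exists b, data2 y0 y1 b 1 0 1, exists b, data2 y0 y1 b 1 0 0 |
      exists b, data2 y0 y1 b 0 0 0].
Proof.
move=> sx; set z := [lie x0, x1].
have dx : data2 x0 x1 'B(z, z) 'B([lie x0, z], [lie x0, z])
  'B([lie x0, z], [lie x1, z]) 'B([lie x1, z], [lie x1, z]) by [].
move: dx; set p := 'B([lie x0, z], _); set q := 'B([lie x0, z], _); set r := 'B([lie x1, z], _).
move=> dx; have [a [b [c [d [D0]]]]] := congruence2 two p q r.
case=> -[s00 s01 s11].
(* Scaling both generators by [l] multiplies the determinant by [l ^+ 2], hence the new S by
   [l ^+ 6] in all; this has to compensate the square of the determinant. *)
- have [l l6] := closed_root (det2 a b c d ^- 2) (isT : (0 < 6)%N).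
  have l0 : l != 0.
    by apply/eqP => l0; move/eqP: l6; rewrite l0 expr0n eq_sym invr_eq0 expf_eq0 (negPf D0).
  exists ((l * a) *: x0 + (l * b) *: x1), ((l * c) *: x0 + (l * d) *: x1).
  split; first by apply: spans2_change sx; rewrite (_ : det2 _ _ _ _ = l ^+ 2 * det2 a b c d);
    [rewrite mulf_neq0 ?expf_neq0 | rewrite /det2; ring].
  constructor 1; eexists.
  have := data2_change (l * a) (l * b) (l * c) (l * d) dx; rewrite /=.
  set D := det2 _ _ _ _; have DE : D = l ^+ 2 * det2 a b c d by rewrite /D /det2; ring.
  have Dl : D ^+ 2 * l ^+ 2 = 1.
    rewrite DE -(mulVf (expf_neq0 2 D0)) -l6; ring.
  set S00 := D ^+ 2 * (_ + _); set S01 := D ^+ 2 * (_ + _); set S11 := D ^+ 2 * (_ + _).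
  have -> : S00 = 1 by rewrite /S00 -[RHS]Dl -[in RHS](mulr1 (l ^+ 2)) -s00; ring.
  have -> : S01 = 0 by rewrite /S01 -[RHS](mulr0 (D ^+ 2 * l ^+ 2)) -s01; ring.
  have -> : S11 = 1 by rewrite /S11 -[RHS]Dl -[in RHS](mulr1 (l ^+ 2)) -s11; ring.
  by apply.
(* In rank 1 the second generator can be scaled to make the determinant 1 without changing the entry
   s00 = 1. *)
- pose m := (det2 a b c d)^-1.
  exists (a *: x0 + b *: x1), ((m * c) *: x0 + (m * d) *: x1).
  have D1 : det2 a b (m * c) (m * d) = 1.
    by rewrite -(mulVf D0) -/m /det2; ring.
  split; first by apply: spans2_change sx; rewrite D1 oner_eq0.
  constructor 2; eexists.
  have := data2_change a b (m * c) (m * d) dx; rewrite /= D1 expr1n !mul1r s00.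
  set S01 := _ + _ + _; set S11 := _ + _ + _.
  have -> : S01 = 0 by rewrite /S01 -[RHS](mulr0 m) -s01; ring.
  have -> : S11 = 0 by rewrite /S11 -[RHS](mulr0 (m ^+ 2)) -s11; ring.
  by apply.
- exists (a *: x0 + b *: x1), (c *: x0 + d *: x1).
  split; first exact: spans2_change.
  constructor 3; eexists.
  by have := data2_change a b c d dx; rewrite /= s00 s01 s11 mulr0; apply.
Qed.

(** Adding [t *: [x0, z]] to [x1] adds [t *: [x0, [x0, z]]] to [z], so B(z, z) changes by -2t
    B([x0, z], [x0, z]) = -2t. The brackets that give S change only by elements of n^5, which is
    orthogonal to n^3. *)
Lemma kill_beta (x0 x1 : L) b s01 s11 : spans (gens (d := 2) [:: x0; x1]) ->
  data2 x0 x1 b 1 s01 s11 ->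
  exists y1 : L, spans (gens (d := 2) [:: x0; y1]) /\ data2 x0 y1 0 1 s01 s11.
Proof.
move=> sx [zz s00_ s01_ s11_]; set z := [lie x0, x1] in zz s00_ s01_ s11_.
have z2 : z \in lc 2 by apply/lcSl/memvf.
have q3 : [lie x0, z] \in lc 3 by apply: lcSr.
set t := 2%:R^-1 * b; exists (x1 + t *: [lie x0, z]); split.
  apply: spans2_perturb sx _ _; first by rewrite subrr mem0v.
  by rewrite addrC addKr memvZ // (lc_mem q3).
have r4 : [lie x0, [lie x0, z]] \in lc 4 by apply: lcSr.
have zE : [lie x0, x1 + t *: [lie x0, z]] = z + t *: [lie x0, [lie x0, z]].
  by rewrite brDr brZr.
have perp i j u v : (6 < i + j)%N -> u \in lc i -> v \in lc j -> 'B(u, v) = 0.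
  by move=> ij; apply: lc_perp ij.
rewrite /data2 zE; set z' := z + _; set y1 := x1 + _.
have z'2 : z' \in lc 2 by rewrite memvD ?memvZ // (lc_mem r4).
have x03 : exists2 u, u \in lc 5 & [lie x0, z'] = [lie x0, z] + u.
  by exists (t *: [lie x0, [lie x0, [lie x0, z]]]); rewrite ?brE // memvZ // lcSr.
have x13 : exists2 u, u \in lc 5 & [lie y1, z'] = [lie x1, z] + u.
  exists (t *: [lie x1, [lie x0, [lie x0, z]]] + t *: [lie [lie x0, z], z']).
    by apply: memvD; apply: memvZ; [apply: lcSr | apply: (lc_br q3 z'2)].
  by rewrite brDl brDr brZr brZl -addrA.
have x1z : [lie x1, z] \in lc 3 by apply: lcSr.
have [u u5 ->] := x03; have [v v5 ->] := x13.
have dd a c e f : a \in lc 3 -> c \in lc 3 -> e \in lc 5 -> f \in lc 5 ->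
    'B(a + e, c + f) = 'B(a, c).
  move=> a3 c3 e5 f5; rewrite fmDl !fmDr (perp 3 5 a f) // (perp 5 3 e c) // (perp 5 5 e f) //.
  by rewrite !addr0.
split; [|exact: etrans (dd _ _ _ _ q3 q3 u5 u5) s00_
  | exact: etrans (dd _ _ _ _ q3 x1z u5 v5) s01_
  | exact: etrans (dd _ _ _ _ x1z x1z v5 v5) s11_].
rewrite fmDl !fmDr !fmZl !fmZr (perp 4 4 [lie x0, _] [lie x0, _]) // (fmC [lie x0, _] z) zz.
rewrite -[ 'B(z, _)]opprK -fm_adj s00_ /t; by field.
Qed.

Lemma kill_gram2 (x0 x1 : L) b s00 s01 s11 : indecomposable L -> lie_type L = 2%N ->
  spans (gens (d := 2) [:: x0; x1]) -> data2 x0 x1 b s00 s01 s11 ->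
  exists y0 y1, [/\ spans (gens (d := 2) [:: y0; y1]), data2 y0 y1 b s00 s01 s11,
    'B(y0, y0) = 0, 'B(y0, y1) = 0 & 'B(y1, y1) = 0].
Proof.
move=> iL tL sx dx; have [w [sw wG wb]] := kill_gram two iL (d := 2) isT tL sx.
exists (x0 + w 0), (x1 + w 1).
have w0 y : [lie x0 + w 0, y] = [lie x0, y] := wb 0 y.
have w1 y : [lie x1 + w 1, y] = [lie x1, y] := wb 1 y.
split; [| | exact: (wG 0 0) | exact: (wG 0 1) | exact: (wG 1 1)].
  by apply: eq_spans sw => -[[|[|i]] ?] //=; congr (_ + w _); apply/val_inj.
by rewrite /data2 !w0 !w1 (brC x0) w1 -brC.
Qed.

End TypeTwo.

Section TypeTwoNormal.
Variables (K : closedFieldType) (L : quadLie K).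
Hypotheses (two : (2%:R : K) != 0).
Local Notation lc := (lower_central L).

Lemma type2_normal_form : indecomposable L -> lie_type L = 2%N -> lc 6 = 0%VS ->
  exists y0 y1 : L, [/\ spans (gens (d := 2) [:: y0; y1]),
    'B(y0, y0) = 0, 'B(y0, y1) = 0, 'B(y1, y1) = 0 &
    [\/ data2 y0 y1 1 0 0 0, data2 y0 y1 0 1 0 0 | data2 y0 y1 0 1 0 1]].
Proof.
move=> iL tL L6; have [x sx0] := spans_exist tL.
have sx : spans (gens (d := 2) [:: x 0; x 1]).
  by apply: eq_spans sx0 => -[[|[|i]] ?] //; congr x; apply/val_inj.
have kill := kill_gram2 two iL tL.
have [y0 [y1 [sy]]] := normal_data2 two sx.
case=> -[b dy].
- have [y1' [sy' dy']] := kill_beta two L6 sy dy.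
  have [z0 [z1 [sz dz G00 G01 G11]]] := kill _ _ _ _ _ _ sy' dy'.
  by exists z0, z1; split=> //; constructor 3.
- have [y1' [sy' dy']] := kill_beta two L6 sy dy.
  have [z0 [z1 [sz dz G00 G01 G11]]] := kill _ _ _ _ _ _ sy' dy'.
  by exists z0, z1; split=> //; constructor 2.
have [b0|b0] := eqVneq b 0.
  rewrite b0 in dy; have [z0 [z1 [sz [E0 E1 E2 E3] G00 G01 G11]]] := kill _ _ _ _ _ _ sy dy.
  case: (@gen_neq0 _ _ _ _ ord0 (nilpotent_lc L6) sz tL) => w k.
  (* Comparison with the zero generators, whose data are the same: all values on words are 0. *)
  have := data2_words (y0 := (0 : L)) (y1 := 0) L6 L6 _ _ _ _ _ _ _ ord0 w k.
  by rewrite !brE !fmE => ->; rewrite ?fmE.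
(* When S = 0, scaling the first generator by the inverse of a square root of [b] turns B(z, z) into
   1. *)
have [m m2] := closed_root b (isT : (0 < 2)%N).
have m0 : m != 0 by apply: contraNneq b0 => m0; rewrite -m2 m0 expr0n.
have D : det2 m^-1 0 0 1 = m^-1 :> K by rewrite /det2; ring.
have sy' := spans2_change (a := m^-1) (b := 0) (c := 0) (d := 1)
  (introN eqP (fun E => negP (invr_neq0 m0) (introT eqP (etrans (esym D) E)))) sy.
have := data2_change m^-1 0 0 1 dy.
rewrite /= D !mulr0 !addr0 mulr0 -m2 exprVn mulVf ?expf_neq0 // => dy'.
have [z0 [z1 [sz dz G00 G01 G11]]] := kill _ _ _ _ _ _ sy' dy'.
by exists z0, z1; split=> //; constructor 1.
Qed.

End TypeTwoNormal.

(** * Type 3 *)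

Section TypeThree.
Variables (K : closedFieldType) (L : quadLie K).
Hypotheses (two : (2%:R : K) != 0).
Local Notation lc := (lower_central L).
Implicit Types (x y z : L).

(** The brackets are taken in cyclic order so that a change of generators acts on them through its
    cofactor matrix ([cross3]). *)
Definition data3 (x0 x1 x2 : L) (t E00 E01 E02 E11 E12 E22 : K) :=
  let e0 := [lie x1, x2] in let e1 := [lie x2, x0] in let e2 := [lie x0, x1] in
  'B(x0, e0) = t /\
  [/\ [/\ 'B(e0, e0) = E00, 'B(e1, e1) = E11 & 'B(e2, e2) = E22],
    'B(e0, e1) = E01, 'B(e0, e2) = E02 & 'B(e1, e2) = E12].

Lemma cross3 x0 x1 x2 (a0 a1 a2 b0 b1 b2 : K) :
  [lie a0 *: x0 + a1 *: x1 + a2 *: x2, b0 *: x0 + b1 *: x1 + b2 *: x2] =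
  (a1 * b2 - a2 * b1) *: [lie x1, x2] + (a2 * b0 - a0 * b2) *: [lie x2, x0]
    + (a0 * b1 - a1 * b0) *: [lie x0, x1].
Proof.
apply: fm_inj => y; rewrite !brE (brC x1 x0) (brC x0 x2) (brC x2 x1) !fmE.
ring.
Qed.

(* If g is the cofactor matrix of h divided by a square root of det h, then h is the
   cofactor matrix of g: the brackets of the new generators are the h-combinations of the
   old ones. *)
Lemma cofactor_change x0 x1 x2 (h00 h01 h02 h10 h11 h12 h20 h21 h22 : K) :
  det3 h00 h01 h02 h10 h11 h12 h20 h21 h22 != 0 ->
  spans (gens (d := 3) [:: x0; x1; x2]) ->
  exists y0 y1 y2, let e0 := [lie x1, x2] in let e1 := [lie x2, x0] in
    let e2 := [lie x0, x1] in
  [/\ spans (gens (d := 3) [:: y0; y1; y2]),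
      [lie y1, y2] = h00 *: e0 + h01 *: e1 + h02 *: e2,
      [lie y2, y0] = h10 *: e0 + h11 *: e1 + h12 *: e2
    & [lie y0, y1] = h20 *: e0 + h21 *: e1 + h22 *: e2].
Proof.
set D := det3 _ _ _ _ _ _ _ _ _ => D0 sx.
have [s s2] := closed_root D (isT : (0 < 2)%N).
have s0 : s != 0 by apply: contraNneq D0 => s0; rewrite -s2 s0 expr0n.
(* Read backwards, [sD] writes [b] as [b * D / s ^+ 2], so that [field] does not need the relation
   between [s] and [D]. *)
have sD a b : a = b * D -> a / s ^+ 2 = b by move=> ->; rewrite s2 mulfK.
exists (((h11 * h22 - h12 * h21) / s) *: x0 + ((h12 * h20 - h10 * h22) / s) *: x1
   + ((h10 * h21 - h11 * h20) / s) *: x2).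
exists (((h21 * h02 - h22 * h01) / s) *: x0 + ((h22 * h00 - h20 * h02) / s) *: x1
   + ((h20 * h01 - h21 * h00) / s) *: x2).
exists (((h01 * h12 - h02 * h11) / s) *: x0 + ((h02 * h10 - h00 * h12) / s) *: x1
   + ((h00 * h11 - h01 * h10) / s) *: x2).
move=> e0 e1 e2; split.
- apply: spans_sub sx _ => i.
  (* The inverse of the change of generators is the transpose of h divided by [s]. *)
  exists (fun j => (nth [::] [:: [:: h00 / s; h10 / s; h20 / s];
    [:: h01 / s; h11 / s; h21 / s]; [:: h02 / s; h12 / s; h22 / s]] i)`_j).
  rewrite !big_ord_recl big_ord0 /gens /=.
  rewrite [X in X \in _](_ : _ = 0) ?mem0v //.
  apply: fm_inj => y; case: i => [[|[|[|i]]] ?] //=; rewrite !fmE;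
    apply/eqP; rewrite subr_eq0; apply/eqP;
    rewrite -[LHS](sD _ _ erefl) /D /det3; by field.
- rewrite cross3 -/e0 -/e1 -/e2; congr (_ *: _ + _ *: _ + _ *: _);
  rewrite -[RHS](sD _ _ erefl) /D /det3; by field.
- rewrite cross3 -/e0 -/e1 -/e2; congr (_ *: _ + _ *: _ + _ *: _);
  rewrite -[RHS](sD _ _ erefl) /D /det3; by field.
- rewrite cross3 -/e0 -/e1 -/e2; congr (_ *: _ + _ *: _ + _ *: _);
  rewrite -[RHS](sD _ _ erefl) /D /det3; by field.
Qed.

Lemma normal_data3 x0 x1 x2 : spans (gens (d := 3) [:: x0; x1; x2]) ->
  exists y0 y1 y2 : L, spans (gens (d := 3) [:: y0; y1; y2]) /\
    exists t r, data3 y0 y1 y2 t (0 < r)%N%:R 0 0 (1 < r)%N%:R 0 (2 < r)%N%:R.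
Proof.
move=> sx; set e0 := [lie x1, x2]; set e1 := [lie x2, x0]; set e2 := [lie x0, x1].
have [h00 [h01 [h02 [h10 [h11 [h12 [h20 [h21 [h22]]]]]]]]] :=
  congruence3 two 'B(e0, e0) 'B(e0, e1) 'B(e0, e2) 'B(e1, e1) 'B(e1, e2) 'B(e2, e2).
case=> D0 [r [[s00 s11 s22] s01 s02 s12]].
have [y0 [y1 [y2 [sy E0 E1 E2]]]] := cofactor_change D0 sx.
exists y0, y1, y2; split=> //; eexists; exists r; split; first reflexivity.
rewrite E0 E1 E2 -/e0 -/e1 -/e2.
split; [split|..]; [rewrite -s00 | rewrite -s11 | rewrite -s22 | rewrite -[RHS]s01
  | rewrite -[RHS]s02 | rewrite -[RHS]s12];
  by rewrite !fmE (fmC e1 e0) (fmC e2 e0) (fmC e2 e1); ring.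
Qed.

Lemma kill_gram3 x0 x1 x2 t E00 E01 E02 E11 E12 E22 :
  indecomposable L -> lie_type L = 3%N -> spans (gens (d := 3) [:: x0; x1; x2]) ->
  data3 x0 x1 x2 t E00 E01 E02 E11 E12 E22 ->
  exists y0 y1 y2 : L, [/\ spans (gens (d := 3) [:: y0; y1; y2]),
    data3 y0 y1 y2 t E00 E01 E02 E11 E12 E22,
    [/\ 'B(y0, y0) = 0, 'B(y0, y1) = 0 & 'B(y0, y2) = 0] &
    [/\ 'B(y1, y1) = 0, 'B(y1, y2) = 0 & 'B(y2, y2) = 0]].
Proof.
move=> iL tL sx dx; have [w [sw wG wb]] := kill_gram two iL (d := 3) isT tL sx.
exists (x0 + w 0), (x1 + w 1), (x2 + w 2).
have w0 y : [lie x0 + w 0, y] = [lie x0, y] := wb 0 y.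
have w1 y : [lie x1 + w 1, y] = [lie x1, y] := wb 1 y.
have w2 y : [lie x2 + w 2, y] = [lie x2, y] := wb 2 y.
split.
- by apply: eq_spans sw => -[[|[|[|i]]] ?] //=; congr (_ + w _); apply/val_inj.
- have E0 : [lie x1 + w 1, x2 + w 2] = [lie x1, x2] by rewrite w1 brC w2 -brC.
  have E1 : [lie x2 + w 2, x0 + w 0] = [lie x2, x0] by rewrite w2 brC w0 -brC.
  have E2 : [lie x0 + w 0, x1 + w 1] = [lie x0, x1] by rewrite w0 brC w1 -brC.
  (* B(x0 + w 0, e0) is B([x0 + w 0, x1], x2) by invariance, and [w 0] is central. *)
  by rewrite /data3 E0 E1 E2 -fm_inv w0 fm_inv.
- by split; [exact: (wG 0 0) | exact: (wG 0 1) | exact: (wG 0 2)].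
- by split; [exact: (wG 1 1) | exact: (wG 1 2) | exact: (wG 2 2)].
Qed.

(** Since B(e0, e0) = 1, subtracting [t *: e0] from [x0] cancels B(x0, e0). The brackets e1 and e2
    change by elements of n^3, which is orthogonal to n^2. *)
Lemma kill_tau x0 x1 x2 t E11 E12 E22 : lc 4 = 0%VS ->
  spans (gens (d := 3) [:: x0; x1; x2]) -> data3 x0 x1 x2 t 1 0 0 E11 E12 E22 ->
  exists y0 : L, spans (gens (d := 3) [:: y0; x1; x2]) /\
    data3 y0 x1 x2 0 1 0 0 E11 E12 E22.
Proof.
move=> L4 sx; rewrite /data3.
set e0 := [lie x1, x2]; set e1 := [lie x2, x0]; set e2 := [lie x0, x1].
case=> tau [[d00 d11 d22] d01 d02 d12].
have e02 : e0 \in lc 2 by apply/lcSl/memvf.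
have e12 : e1 \in lc 2 by apply/lcSl/memvf.
have e22 : e2 \in lc 2 by apply/lcSl/memvf.
have dd a c e f : a \in lc 2 -> c \in lc 2 -> e \in lc 3 -> f \in lc 3 ->
    'B(a + e, c + f) = 'B(a, c).
  have perp i j u v : (4 < i + j)%N -> u \in lc i -> v \in lc j -> 'B(u, v) = 0.
    by move=> ij; apply: lc_perp ij.
  move=> a2 c2 e3 f3; rewrite fmDl !fmDr (perp 2 3 a f) // (perp 3 2 e c) //.
  by rewrite (perp 3 3 e f) // !addr0.
exists (x0 - t *: e0); split.
  by apply: spans3_perturb sx _ _ _; rewrite ?subrr ?mem0v // addrC addKr memvN memvZ.
have -> : [lie x2, x0 - t *: e0] = e1 + - (t *: [lie x2, e0]) by rewrite !brE.
have -> : [lie x0 - t *: e0, x1] = e2 + - (t *: [lie e0, x1]) by rewrite !brE.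
have a3 : - (t *: [lie x2, e0]) \in lc 3 by rewrite memvN memvZ // lcSr.
have b3 : - (t *: [lie e0, x1]) \in lc 3 by rewrite memvN memvZ // lcSl.
have o3 : 0 \in lc 3 by rewrite mem0v.
split; first by rewrite !fmE tau d00 mulr1 subrr.
split; [split=> //|..].
- by rewrite dd.
- by rewrite dd.
- by rewrite -[X in 'B(X, _)]addr0 dd.
- by rewrite -[X in 'B(X, _)]addr0 dd.
- by rewrite dd.
Qed.

Lemma type3_normal_form : indecomposable L -> lie_type L = 3%N -> lc 4 = 0%VS ->
  exists y0 y1 y2 : L, [/\ spans (gens (d := 3) [:: y0; y1; y2]),
    [/\ 'B(y0, y0) = 0, 'B(y0, y1) = 0 & 'B(y0, y2) = 0],
    [/\ 'B(y1, y1) = 0, 'B(y1, y2) = 0 & 'B(y2, y2) = 0] &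
    [\/ data3 y0 y1 y2 1 0 0 0 0 0 0, data3 y0 y1 y2 0 1 0 0 1 0 0
      | data3 y0 y1 y2 0 1 0 0 1 0 1]].
Proof.
move=> iL tL L4; have [x sx0] := spans_exist tL.
have sx : spans (gens (d := 3) [:: x 0; x 1; x 2]).
  by apply: eq_spans sx0 => -[[|[|[|i]]] ?] //; congr x; apply/val_inj.
have [y0 [y1 [y2 [sy [t [r dy]]]]]] := normal_data3 sx.
have [r0|r_gt0] := posnP r.
  have [t0|t0] := eqVneq t 0.
    rewrite t0 r0 in dy; have [z0 [z1 [z2 [sz dz [G00 G01 G02] [G11 G12 G22]]]]] :=
      kill_gram3 iL tL sy dy.
    case: dz => /= tau [[E00 E11 E22] E01 E02 E12].
    case: (@gen_neq0 _ _ _ _ ord0 (nilpotent_lc L4) sz tL) => w k.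
    have := data3_words (y0 := (0 : L)) (y1 := 0) (y2 := 0) L4 L4 _ _ _ _ _ _ _ _ _ _ _ _ _
      ord0 w k.
    by rewrite !brE !fmE => ->; rewrite ?fmE.
  (* For E = 0, dividing one generator by [t] normalises B(x0, e0) to 1. *)
  have sy' : spans (gens (d := 3) [:: t^-1 *: y0; y1; y2]).
    apply: spans_sub sy _ => i; exists (fun j => (i == j)%:R * [:: t; 1; 1]`_j).
    rewrite !big_ord_recl big_ord0 /gens /=.
    rewrite [X in X \in _](_ : _ = 0) ?mem0v //; apply: fm_inj => y.
    by case: i => [[|[|[|i]]] ?] //=; rewrite !fmE; field.
  have dy' : data3 (t^-1 *: y0) y1 y2 1 0 0 0 0 0 0.
    move: dy; rewrite /data3 r0 => /= -[tau [[E00 E11 E22] E01 E02 E12]].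
    by split; [|split; [split| | |]]; rewrite ?brE ?fmE ?tau ?mulVf //
      ?E00 ?E11 ?E22 ?E01 ?E02 ?E12 ?mulr0.
  have [z0 [z1 [z2 [sz dz G0 G1]]]] := kill_gram3 iL tL sy' dy'.
  by exists z0, z1, z2; split=> //; constructor 1.
rewrite r_gt0 in dy; have [u0 [su du]] := kill_tau L4 sy dy.
have [z0 [z1 [z2 [sz dz G0 G1]]]] := kill_gram3 iL tL su du.
have [r2|r1] := ltnP 1 r; last first.
  (* Rank 1 is impossible: the data would agree with those of 0, [z1], [z2], so [z0] would be
     orthogonal to all words. *)
  case: G0 G1 dz => G00 G01 G02 [G11 G12 G22].
  rewrite /data3 !ltnNge r1 (leq_trans r1) //= => -[tau [[E00 E11 E22] E01 E02 E12]].
  case: (@gen_neq0 _ _ _ _ ord0 (nilpotent_lc L4) sz tL) => w k.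
  have := data3_words (y0 := (0 : L)) (y1 := z1) (y2 := z2) L4 L4 _ _ _ _ _ _ _ _ _ _ _ _ _
    ord0 w k.
  by rewrite !brE !fmE => ->; rewrite ?fmE ?G00 ?G11.
exists z0, z1, z2; split=> //; move: dz; rewrite r2.
by case: (2 < r)%N; [constructor 3 | constructor 2].
Qed.

End TypeThree.

(** * The algebras given by tables *)

Section TableVectors.
Variables (K : fieldType) (m : nat).
Local Notation n := m.+1.

(* f 0 is ignored, so a list of coordinates passed as nth 0 s starts with a junk value. *)
Definition tvec (f : nat -> K) : 'rV[K]_n := \row_j f j.+1.
Definition bas (i : nat) : 'rV[K]_n := tvec (fun l => (l == i)%:R).

Lemma crd_tvec f l : (0 < l <= n)%N -> crd (tvec f) l = f l.
Proof. by case: l => // l ln; rewrite /crd mxE inordK. Qed.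

Lemma crdZ a (x : 'rV[K]_n) l : crd (a *: x) l = a * crd x l.
Proof. by rewrite /crd mxE. Qed.

Lemma crdN (x : 'rV[K]_n) l : crd (- x) l = - crd x l.
Proof. by rewrite /crd mxE. Qed.

Variable T : seq (nat * nat * int * nat).
Hypothesis TJ : tjacobi K m T.

(* wt lists the weights of a_1, a_2, ... from index 1 on; its head is junk. *)
Lemma table_lc (wt : seq nat) N k (x : tlie TJ) l :
  all (fun t => let: (i, j, _, k) := t in
         [&& (nth 0 wt i < nth 0 wt k)%N, (nth 0 wt j < nth 0 wt k)%N,
             (0 < i <= n)%N & (0 < j <= n)%N]) T ->
  all (fun l => (0 < nth 0 wt l)%N && (nth 0 wt l <= N)%N) (iota 1 n) ->
  x \in lower_central (tlie TJ) k.+1 ->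
  (0 < l <= n)%N -> (nth 0 wt l <= k)%N -> crd (x : 'rV[K]_n) l = 0.
Proof.
move=> /allP wT /allP wN xk ln lk.
(* Coordinates as linear maps, so that their vanishing is membership in a kernel and [lc_ind]
   applies. A product is strictly heavier than its two factors, so each step of the series kills one
   more weight. *)
pose f l' : 'Hom(tlie TJ, 'rV[K]_1) := linfun (mulmxr (delta_mx (inord l'.-1) 0)).
have fE l' (y : tlie TJ) : (y \in lker (f l')) = (crd (y : 'rV[K]_n) l' == 0).
  rewrite memv_ker lfunE /= -colE; apply/eqP/eqP => [/rowP/(_ 0)|yl].
    by rewrite !mxE.
  by apply/rowP => i; rewrite !mxE.
apply/eqP; rewrite -fE; apply: subvP xk.
elim: k l ln lk => [|k IH] l ln lk.
  have /wN : l \in iota 1 n by rewrite mem_iota add1n ltnS.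
  by rewrite ltnNge lk.
apply: lc_ind => u v uk; rewrite fE; apply/eqP.
rewrite crd_tbracket //; move: lk; rewrite /cbracket.
have : {subset T <= T} by [].
elim: {1 3}T => //= -[[[i j] c] l'] s IHs sT lk.
have sT' : {subset s <= T} by move=> t ts; rewrite sT // inE ts orbT.
have IHs' := IHs sT' lk.
case: eqP => // El; rewrite IHs' addr0.
have /wT := sT _ (mem_head _ _); rewrite El => /and4P[il jl i_n j_n].
have u0 i' : (0 < i' <= n)%N -> (nth 0 wt i' < nth 0 wt l)%N -> crd (u : 'rV[K]_n) i' = 0.
  move=> i'n i'l; apply/eqP; rewrite -fE; apply: subvP uk; apply: IH => //.
  by rewrite -ltnS (leq_trans i'l).
by rewrite !u0 // !mul0r subrr mulr0.
Qed.

Lemma table_lc0 (wt : seq nat) N :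
  all (fun t => let: (i, j, _, k) := t in
         [&& (nth 0 wt i < nth 0 wt k)%N, (nth 0 wt j < nth 0 wt k)%N,
             (0 < i <= n)%N & (0 < j <= n)%N]) T ->
  all (fun l => (0 < nth 0 wt l)%N && (nth 0 wt l <= N)%N) (iota 1 n) ->
  lower_central (tlie TJ) N.+1 = 0%VS.
Proof.
move=> wT wN; apply/eqP; rewrite -subv0; apply/subvP => x xN; rewrite memv0; apply/eqP.
apply: (@crd_eqP K m x 0) => l ln; rewrite crd0; apply: (table_lc wT wN) xN _ _.
  by move: ln; rewrite mem_iota add1n ltnS.
by have /andP[] := allP wN _ ln.
Qed.

(** A certificate for membership in n^2: [f] and [g] list, after a junk head, the coordinates of [u]
    and [w] in [v = [u, a_1] + [w, a_2]]. In each table such brackets give all of n^2. *)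
Lemma lc2_brackets (v : tlie TJ) (f g : seq K) :
  let u := tvec (nth 0 f) in let w := tvec (nth 0 g) in
  (forall l, l \in iota 1 n -> crd (v : 'rV[K]_n) l =
     crd (tbracket T u (bas 1)) l + crd (tbracket T w (bas 2)) l) ->
  v \in lower_central (tlie TJ) 2.
Proof.
have lc2 (x y : tlie TJ) : (tbracket T x y : tlie TJ) \in lower_central (tlie TJ) 2.
  exact: (@lcSl _ (tlie TJ) 1 x y (memvf x)).
move=> u w vl; have -> : v = tbracket T u (bas 1) + tbracket T w (bas 2).
  by apply: (@crd_eqP K m) => l ln; rewrite crdD vl.
by rewrite (@memvD _ (tlie TJ)).
Qed.

End TableVectors.

Ltac crd_simp := rewrite ?(crdD, crdN, crdZ, crd0); rewrite ?crd_tbracket //;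
  rewrite /cbracket /=; rewrite ?crd_tbracket //; rewrite /cbracket /=;
  rewrite ?crd_tbracket //; rewrite /cbracket /=; rewrite ?crd_tvec //=.

Ltac row_tac := move=> l; rewrite !inE; repeat case/orP;
  move/eqP=> ->; crd_simp; ring.

Ltac form_tac := rewrite tform_cform;
  match goal with |- context [fsupp ?m ?f] =>
    let s := eval vm_compute in (fsupp m f) in
    rewrite (_ : fsupp m f = s); last by vm_compute
  end; rewrite /cform /=; crd_simp; rewrite ?NegzE; ring.

Section Tables.
Variable K : closedFieldType.

Local Notation c v i := (crd (v : 'rV[K]__) i).

Lemma n11_lc2 : lower_central (n11 K) 2 = 0%VS.
Proof. by apply: (@table_lc0 _ _ _ _ [:: 0; 1]). Qed.

Lemma n11_spans : spans (gens (d := 1) [:: bas K 0 1 : n11 K]).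
Proof.
apply/spans1P => v; exists (c v 1).
by apply: (lc2_brackets (f := [::]) (g := [::])); row_tac.
Qed.

Lemma n11_data : 'B(bas K 0 1 : n11 K, bas K 0 1 : n11 K) = 1.
Proof. by rewrite /=; form_tac. Qed.

Lemma n23_lc4 : lower_central (n23 K) 4 = 0%VS.
Proof. by apply: (@table_lc0 _ _ _ _ [:: 0; 1; 1; 2; 3; 3]). Qed.

Lemma n23_spans : spans (gens (d := 2) [:: bas K 4 2 : n23 K; bas K 4 1 : n23 K]).
Proof.
apply/spans2P => v; exists (c v 2), (c v 1).
apply: (lc2_brackets (f := [:: 0; 0; c v 3; c v 4]) (g := [:: 0; 0; 0; c v 5])).
by row_tac.
Qed.

Lemma n23_data : data2 (bas K 4 2 : n23 K) (bas K 4 1 : n23 K) 1 0 0 0.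
Proof. by split; rewrite /=; form_tac. Qed.

Lemma n23_gram (y0 := bas K 4 2 : n23 K) (y1 := bas K 4 1 : n23 K) :
  [/\ 'B(y0, y0) = 0, 'B(y0, y1) = 0 & 'B(y1, y1) = 0].
Proof. by rewrite /y0 /y1; split; rewrite /=; form_tac. Qed.

Lemma n25_1_lc6 : lower_central (n25_1 K) 6 = 0%VS.
Proof. by apply: (@table_lc0 _ _ _ _ [:: 0; 1; 1; 2; 3; 4; 5; 5]). Qed.

Lemma n25_1_spans : spans (gens (d := 2) [:: bas K 6 1 : n25_1 K; bas K 6 2 : n25_1 K]).
Proof.
apply/spans2P => v; exists (c v 1), (c v 2).
by apply: (lc2_brackets (f := [:: 0; 0; c v 3; c v 4; c v 5; c v 6]) (g := [:: 0; 0; 0; 0; 0;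
  c v 7])); row_tac.
Qed.

(** Here z = -a_3, [a_1, z] = a_4 and [a_2, z] = 0. *)
Lemma n25_1_data : data2 (bas K 6 1 : n25_1 K) (bas K 6 2 : n25_1 K) 0 1 0 0.
Proof. by split; rewrite /=; form_tac. Qed.

Lemma n25_1_gram (y0 := bas K 6 1 : n25_1 K) (y1 := bas K 6 2 : n25_1 K) :
  [/\ 'B(y0, y0) = 0, 'B(y0, y1) = 0 & 'B(y1, y1) = 0].
Proof. by rewrite /y0 /y1; split; rewrite /=; form_tac. Qed.

Lemma n25_2_lc6 : lower_central (n25_2 K) 6 = 0%VS.
Proof. by apply: (@table_lc0 _ _ _ _ [:: 0; 1; 1; 2; 3; 3; 4; 5; 5]). Qed.

Lemma n25_2_spans : spans (gens (d := 2) [:: bas K 7 1 : n25_2 K; bas K 7 2 : n25_2 K]).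
Proof.
apply/spans2P => v; exists (c v 1), (c v 2).
by apply: (lc2_brackets (f := [:: 0; 0; c v 3; c v 4; c v 6; 0; c v 7]) (g := [:: 0; 0; 0;
  c v 5; 0; 0; c v 8])); row_tac.
Qed.

(** Here [a_1, z] = a_4 and [a_2, z] = a_5, which are orthonormal. *)
Lemma n25_2_data : data2 (bas K 7 1 : n25_2 K) (bas K 7 2 : n25_2 K) 0 1 0 1.
Proof. by split; rewrite /=; form_tac. Qed.

Lemma n25_2_gram (y0 := bas K 7 1 : n25_2 K) (y1 := bas K 7 2 : n25_2 K) :
  [/\ 'B(y0, y0) = 0, 'B(y0, y1) = 0 & 'B(y1, y1) = 0].
Proof. by rewrite /y0 /y1; split; rewrite /=; form_tac. Qed.

Lemma n32_lc4 : lower_central (n32 K) 4 = 0%VS.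
Proof. by apply: (@table_lc0 _ _ _ _ [:: 0; 1; 1; 1; 2; 2; 2]). Qed.

Lemma n32_spans : spans (gens (d := 3) [:: bas K 5 3 : n32 K; bas K 5 2 : n32 K;
  bas K 5 1 : n32 K]).
Proof.
apply/spans3P => v; exists (c v 3), (c v 2), (c v 1).
by apply: (lc2_brackets (f := [:: 0; 0; c v 4; c v 5]) (g := [:: 0; 0; 0; c v 6])); row_tac.
Qed.

(** The order a_3, a_2, a_1 gives B(a_3, [a_2, a_1]) = B(a_3, a_4) = 1; the order a_1, a_2, a_3
    would give -1. *)
Lemma n32_data : data3 (bas K 5 3 : n32 K) (bas K 5 2 : n32 K) (bas K 5 1 : n32 K) 1 0 0 0 0 0 0.
Proof. by split; [|split; [split|..]]; rewrite /=; form_tac. Qed.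

Lemma n32_gram (y0 := bas K 5 3 : n32 K) (y1 := bas K 5 2 : n32 K) (y2 := bas K 5 1 : n32 K) :
  [/\ 'B(y0, y0) = 0, 'B(y0, y1) = 0 & 'B(y0, y2) = 0] /\
  [/\ 'B(y1, y1) = 0, 'B(y1, y2) = 0 & 'B(y2, y2) = 0].
Proof. by rewrite /y0 /y1 /y2; split; split; rewrite /=; form_tac. Qed.

Lemma n33_1_lc4 : lower_central (n33_1 K) 4 = 0%VS.
Proof. by apply: (@table_lc0 _ _ _ _ [:: 0; 1; 1; 1; 2; 2; 3; 3; 3]). Qed.

Lemma n33_1_spans : spans (gens (d := 3) [:: bas K 7 3 : n33_1 K; bas K 7 2 : n33_1 K;
  bas K 7 1 : n33_1 K]).
Proof.
apply/spans3P => v; exists (c v 3), (c v 2), (c v 1).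
by apply: (lc2_brackets (f := [:: 0; 0; c v 4; c v 5; c v 6; c v 8]) (g := [:: 0; 0; 0; 0;
  c v 7])); row_tac.
Qed.

(** In the order a_3, a_2, a_1 the brackets are a_4, -a_5 and 0, so the vanishing one comes last. *)
Lemma n33_1_data : data3 (bas K 7 3 : n33_1 K) (bas K 7 2 : n33_1 K) (bas K 7 1
  : n33_1 K) 0 1 0 0 1 0 0.
Proof. by split; [|split; [split|..]]; rewrite /=; form_tac. Qed.

Lemma n33_1_gram (y0 := bas K 7 3 : n33_1 K) (y1 := bas K 7 2 : n33_1 K) (y2 := bas K 7 1
  : n33_1 K) :
  [/\ 'B(y0, y0) = 0, 'B(y0, y1) = 0 & 'B(y0, y2) = 0] /\
  [/\ 'B(y1, y1) = 0, 'B(y1, y2) = 0 & 'B(y2, y2) = 0].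
Proof. by rewrite /y0 /y1 /y2; split; split; rewrite /=; form_tac. Qed.

Lemma n33_2_lc4 : lower_central (n33_2 K) 4 = 0%VS.
Proof. by apply: (@table_lc0 _ _ _ _ [:: 0; 1; 1; 1; 2; 2; 2; 3; 3; 3]). Qed.

Lemma n33_2_spans : spans (gens (d := 3) [:: bas K 8 3 : n33_2 K; bas K 8 2 : n33_2 K;
  bas K 8 1 : n33_2 K]).
Proof.
apply/spans3P => v; exists (c v 3), (c v 2), (c v 1).
by apply: (lc2_brackets (f := [:: 0; 0; c v 4; c v 5; c v 7; c v 9]) (g := [:: 0; 0; 0; c v 6;
  c v 8])); row_tac.
Qed.

Lemma n33_2_data : data3 (bas K 8 3 : n33_2 K) (bas K 8 2 : n33_2 K) (bas K 8 1
  : n33_2 K) 0 1 0 0 1 0 1.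
Proof. by split; [|split; [split|..]]; rewrite /=; form_tac. Qed.

Lemma n33_2_gram (y0 := bas K 8 3 : n33_2 K) (y1 := bas K 8 2 : n33_2 K) (y2 := bas K 8 1
  : n33_2 K) :
  [/\ 'B(y0, y0) = 0, 'B(y0, y1) = 0 & 'B(y0, y2) = 0] /\
  [/\ 'B(y1, y1) = 0, 'B(y1, y2) = 0 & 'B(y2, y2) = 0].
Proof. by rewrite /y0 /y1 /y2; split; split; rewrite /=; form_tac. Qed.

Lemma n23_indep a b :
  a *: (bas K 4 2 : n23 K) + b *: (bas K 4 1 : n23 K) \in lower_central (n23 K) 2 ->
  a = 0 /\ b = 0.
Proof.
move=> ab.
have E l : (0 < l <= 5)%N -> (nth 0 [:: 0; 1; 1; 2; 3; 3] l <= 1)%N ->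
    crd (a *: bas K 4 2 + b *: bas K 4 1) l = 0.
  exact: (@table_lc _ _ _ _ [:: 0; 1; 1; 2; 3; 3] 3 1 _ _ _ _ ab).
have := E 2 isT isT; have := E 1 isT isT.
by rewrite !(crdD, crdZ) !crd_tvec //= !(mulr0, mulr1, add0r, addr0).
Qed.

Lemma n25_1_indep a b :
  a *: (bas K 6 1 : n25_1 K) + b *: (bas K 6 2 : n25_1 K) \in lower_central (n25_1 K) 2 ->
  a = 0 /\ b = 0.
Proof.
move=> ab.
have E l : (0 < l <= 7)%N -> (nth 0 [:: 0; 1; 1; 2; 3; 4; 5; 5] l <= 1)%N ->
    crd (a *: bas K 6 1 + b *: bas K 6 2) l = 0.
  exact: (@table_lc _ _ _ _ [:: 0; 1; 1; 2; 3; 4; 5; 5] 5 1 _ _ _ _ ab).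
have := E 1 isT isT; have := E 2 isT isT.
by rewrite !(crdD, crdZ) !crd_tvec //= !(mulr0, mulr1, add0r, addr0).
Qed.

Lemma n25_2_indep a b :
  a *: (bas K 7 1 : n25_2 K) + b *: (bas K 7 2 : n25_2 K) \in lower_central (n25_2 K) 2 ->
  a = 0 /\ b = 0.
Proof.
move=> ab.
have E l : (0 < l <= 8)%N -> (nth 0 [:: 0; 1; 1; 2; 3; 3; 4; 5; 5] l <= 1)%N ->
    crd (a *: bas K 7 1 + b *: bas K 7 2) l = 0.
  exact: (@table_lc _ _ _ _ [:: 0; 1; 1; 2; 3; 3; 4; 5; 5] 5 1 _ _ _ _ ab).
have := E 1 isT isT; have := E 2 isT isT.
by rewrite !(crdD, crdZ) !crd_tvec //= !(mulr0, mulr1, add0r, addr0).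
Qed.

End Tables.

(** * Isometries from normalised data *)

Section Isometries.
Variable K : closedFieldType.
Implicit Types (L M : quadLie K).

Lemma data2_isometric L M (x0 x1 : L) (y0 y1 : M) b s00 s01 s11 :
  lower_central L 6 = 0%VS -> lower_central M 6 = 0%VS ->
  spans (gens (d := 2) [:: x0; x1]) -> spans (gens (d := 2) [:: y0; y1]) ->
  'B(x0, x0) = 'B(y0, y0) -> 'B(x0, x1) = 'B(y0, y1) -> 'B(x1, x1) = 'B(y1, y1) ->
  data2 x0 x1 b s00 s01 s11 -> data2 y0 y1 b s00 s01 s11 -> isometric L M.
Proof.
move=> L6 M6 sx sy G00 G01 G11 [<- <- <- <-] [b' s00' s01' s11'].
apply: (data_isometric (nilpotent_lc L6) (nilpotent_lc M6) sx sy).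
exact: data2_words.
Qed.

Lemma data3_isometric L M (x0 x1 x2 : L) (y0 y1 y2 : M) t E00 E01 E02 E11 E12 E22 :
  lower_central L 4 = 0%VS -> lower_central M 4 = 0%VS ->
  spans (gens (d := 3) [:: x0; x1; x2]) -> spans (gens (d := 3) [:: y0; y1; y2]) ->
  'B(x0, x0) = 'B(y0, y0) -> 'B(x0, x1) = 'B(y0, y1) -> 'B(x0, x2) = 'B(y0, y2) ->
  'B(x1, x1) = 'B(y1, y1) -> 'B(x1, x2) = 'B(y1, y2) -> 'B(x2, x2) = 'B(y2, y2) ->
  data3 x0 x1 x2 t E00 E01 E02 E11 E12 E22 ->
  data3 y0 y1 y2 t E00 E01 E02 E11 E12 E22 -> isometric L M.
Proof.
move=> L4 M4 sx sy G00 G01 G02 G11 G12 G22.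
move=> [<- [[<- <- <-] <- <- <-]] [t' [[E00' E11' E22'] E01' E02' E12']].
apply: (data_isometric (nilpotent_lc L4) (nilpotent_lc M4) sx sy).
exact: data3_words.
Qed.

Lemma nilindex_le_lc0 (L : lieAlgebra K) m N : (m < N)%N -> nilindex_le L m ->
  lower_central L N = 0%VS.
Proof.
move=> mN [t tm [L0 _]]; apply/eqP; rewrite -subv0 -L0 lcS //.
exact: leq_ltn_trans mN.
Qed.

Lemma lc0_nilindex_le (L : lieAlgebra K) m : {:L}%VS <> 0%VS ->
  lower_central L m.+1 = 0%VS -> nilindex_le L m.
Proof.
move=> L0 Lm; have exP : exists t, lower_central L t.+1 == 0%VS by exists m; apply/eqP.
case: (ex_minnP exP) => t /eqP Lt tmin; exists t; first by apply: tmin; apply/eqP.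
(* For [t = 0] the goal concerns the junk value [lower_central L 0], the whole space, which is
   nonzero by assumption. *)
split=> //; case: t Lt tmin => [|t] Lt tmin; first exact: L0.
by move=> Lt'; have := tmin t; rewrite Lt' eqxx ltnn => /(_ isT).
Qed.

(** With one generator all longer words vanish, so B(x, x) is the only datum; it is nonzero by
    [gen_neq0] and a square root scales it to 1. *)
Lemma type1_isometric L : [pchar K] =i pred0 -> lie_nilpotent L -> lie_type L = 1%N ->
  isometric L (n11 K).
Proof.
move=> cK nL tL; have [x sx0] := spans_exist tL.
have sx : spans (gens (d := 1) [:: x 0]).
  by apply: eq_spans sx0 => -[[|i] ?] //; congr x; apply/val_inj.
have G0 : 'B(x 0, x 0) != 0.
  apply/eqP => G0; apply: (@gen_neq0 _ _ _ _ ord0 nL sx tL) => w k.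
  have := word_gens1 (x 0) w k.
  by case: w => [|j w]; rewrite ?ord1 // => ->; rewrite ?fm0r.
have [m m2] := closed_root 'B(x 0, x 0) (isT : (0 < 2)%N).
have m0 : m != 0 by apply: contraNneq G0 => m0; rewrite -m2 m0 expr0n.
apply: (data1_isometric (x := m^-1 *: x 0) (y := bas K 0 1 : n11 K) nL) => //.
- exact: nilpotent_lc (n11_lc2 K).
- apply/spans1P => v; have [a av] := (spans1P _).1 sx v.
  by exists (a * m); rewrite scalerA mulfK.
- exact: n11_spans.
- by rewrite fmZl fmZr -m2 n11_data; field.
Qed.

End Isometries.

(** * Classification *)

Section Classification.
Variables (K : closedFieldType) (cK : [pchar K] =i pred0).
Implicit Types (L M : quadLie K).

Lemma type2_classification L : indecomposable L -> lie_type L = 2%N ->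
  lower_central L 6 = 0%VS ->
  [\/ isometric L (n23 K), isometric L (n25_1 K) | isometric L (n25_2 K)].
Proof.
move=> iL tL L6.
have [y0 [y1 [sy G00 G01 G11 dy]]] := type2_normal_form (natr_neq0 cK 1) iL tL L6.
case: dy => dy; [constructor 1 | constructor 2 | constructor 3].
- have [H00 H01 H11] := n23_gram K.
  apply: (data2_isometric L6 _ sy (@n23_spans K) _ _ _ dy (n23_data K));
    rewrite ?G00 ?G01 ?G11 //.
  by apply/eqP; rewrite -subv0 -(n23_lc4 K) lcS.
- have [H00 H01 H11] := n25_1_gram K.
  by apply: (data2_isometric L6 (n25_1_lc6 K) sy (@n25_1_spans K) _ _ _ dy (n25_1_data K));
    rewrite ?G00 ?G01 ?G11.
- have [H00 H01 H11] := n25_2_gram K.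
  by apply: (data2_isometric L6 (n25_2_lc6 K) sy (@n25_2_spans K) _ _ _ dy (n25_2_data K));
    rewrite ?G00 ?G01 ?G11.
Qed.

Lemma type3_classification L : indecomposable L -> lie_type L = 3%N ->
  lower_central L 4 = 0%VS ->
  [\/ isometric L (n32 K), isometric L (n33_1 K) | isometric L (n33_2 K)].
Proof.
move=> iL tL L4.
have [y0 [y1 [y2 [sy [G00 G01 G02] [G11 G12 G22] dy]]]] :=
  type3_normal_form (natr_neq0 cK 1) iL tL L4.
case: dy => dy; [constructor 1 | constructor 2 | constructor 3].
- have [[H00 H01 H02] [H11 H12 H22]] := n32_gram K.
  by apply: (data3_isometric L4 (n32_lc4 K) sy (@n32_spans K) _ _ _ _ _ _ dy (n32_data K));
    rewrite ?G00 ?G01 ?G02 ?G11 ?G12 ?G22.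
- have [[H00 H01 H02] [H11 H12 H22]] := n33_1_gram K.
  by apply: (data3_isometric L4 (n33_1_lc4 K) sy (@n33_1_spans K) _ _ _ _ _ _ dy (n33_1_data K));
    rewrite ?G00 ?G01 ?G02 ?G11 ?G12 ?G22.
- have [[H00 H01 H02] [H11 H12 H22]] := n33_2_gram K.
  by apply: (data3_isometric L4 (n33_2_lc4 K) sy (@n33_2_spans K) _ _ _ _ _ _ dy (n33_2_data K));
    rewrite ?G00 ?G01 ?G02 ?G11 ?G12 ?G22.
Qed.

End Classification.

Section Commuting.
Variables (K : fieldType) (L : lieAlgebra K) (d : nat) (x : 'I_d -> L).

Lemma commuting_abelian : lie_nilpotent L -> spans x ->
  (forall i j, [lie x i, x j] = 0) -> lie_abelian L.
Proof.
move=> nL sx xx.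
have full v : (forall i, [lie v, x i] = 0) -> forall u, [lie v, u] = 0.
  move=> vx u; apply/eqP; rewrite -memv0 -mem_ad_preim.
  rewrite (words_full nL sx (U := ad_preim v 0)) ?memvf // => w k.
  elim: w k => [|i w IH] k; first by rewrite mem_ad_preim memv0 vx.
  rewrite mem_ad_preim memv0 /= br_ad vx br0l add0r.
  by move: (IH k); rewrite mem_ad_preim memv0 => /eqP->; rewrite br0r.
move=> u v; apply: (full) => i; rewrite brC full ?oppr0 // => j; exact: xx.
Qed.

End Commuting.

(** * Transport along isometries and orthogonal sums *)

Section Transport.
Variable K : fieldType.
Implicit Types (L M : quadLie K).

Lemma isometric_refl L : isometric L L.
Proof. by exists idfun; split=> //; exists idfun. Qed.

Lemma isometric_trans L1 L2 L3 : isometric L1 L2 -> isometric L2 L3 -> isometric L1 L3.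
Proof.
move=> [f [fb fl ff]] [g [gb gl gf]]; exists (g \o f); split=> /=.
- exact: bij_comp.
- by move=> x y; rewrite fl gl.
- by move=> x y; rewrite gf ff.
Qed.

Lemma osum_isometric L M M' : isometric M M' -> isometric (osum L M) (osum L M').
Proof.
move=> [f [[f' fK f'K] fl ff]].
pose g (u : osum L M) : osum L M' := (u.1, f u.2).
have g_lin : linear g by move=> a u v; rewrite /g /= linearP.
pose G0 := GRing.isLinear.Build K (osum L M) (osum L M') *:%R g g_lin.
pose G : {linear osum L M -> osum L M'} := HB.pack g G0.
exists G; split=> /=.
- exists (fun u : osum L M' => (u.1, f' u.2)) => -[u v]; rewrite /g /=.
    by rewrite fK.
  by rewrite f'K.
- by move=> u v; rewrite /g /osum_bracket /= fl.
- by move=> u v; rewrite /g /osum_form /= ff.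
Qed.

Lemma isometric_dim_lc L M i : isometric L M ->
  \dim (lower_central L i) = \dim (lower_central M i).
Proof.
case=> f [[f' fK f'K] fl _]; pose F := linfun f.
have F0 : lker F == 0%VS by apply/lker0P => u v; rewrite !lfunE; apply: (can_inj fK).
rewrite -(@limg_dim_eq _ _ _ F) ?(eqP F0) ?capv0 //; congr (\dim _).
apply/eqP; rewrite eqEsubv; elim: i => [|[|i] /andP[IH1 IH2]].
- rewrite subvf; apply/subvP => v _; apply/memv_imgP.
  by exists (f' v); rewrite ?memvf // lfunE /= f'K.
- rewrite subvf; apply/subvP => v _; apply/memv_imgP.
  by exists (f' v); rewrite ?memvf // lfunE /= f'K.
apply/andP; split.
  have : (lower_central L i.+2 <= F @^-1: lower_central M i.+2)%VS.
    apply: lc_ind => u v ui; rewrite -memv_preim lfunE fl lcSl //.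
    by apply: (subvP IH1); rewrite -lfunE memv_img.
  by move/(limgS F)/subv_trans; apply; apply/subvP => v /memv_imgP[u];
    rewrite -memv_preim => uM ->.
apply: lc_ind => u v /(subvP IH2) /memv_imgP[u' u'i ->].
have -> : v = F (f' v) by rewrite lfunE /= f'K.
by rewrite !lfunE -fl -(lfunE f) memv_img // lcSl.
Qed.

End Transport.

Section OrthogonalSumSpans.
Variables (K : fieldType) (L M : quadLie K).

Lemma osum_lc2 (u : L) (v : M) : u \in lower_central L 2 -> v \in lower_central M 2 ->
  ((u, v) : osum L M) \in lower_central (osum L M) 2.
Proof.
have lin1 : linear (fun u : L => (u, 0) : osum L M).
  by move=> a x y; congr pair; rewrite /= scaler0 addr0.
have lin2 : linear (fun v : M => (0, v) : osum L M).
  by move=> a x y; congr pair; rewrite /= scaler0 addr0.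
pose I1 := GRing.isLinear.Build K L (osum L M) *:%R _ lin1.
pose I2 := GRing.isLinear.Build K M (osum L M) *:%R _ lin2.
pose i1 : {linear L -> osum L M} := HB.pack (fun u : L => (u, 0) : osum L M) I1.
pose i2 : {linear M -> osum L M} := HB.pack (fun v : M => (0, v) : osum L M) I2.
have H1 : (lower_central L 2 <= linfun i1 @^-1: lower_central (osum L M) 2)%VS.
  apply: lc_ind => x y _; rewrite -memv_preim lfunE.
  have -> : i1 [lie x, y] = [lie (i1 x), i1 y].
    by rewrite /= /osum_bracket /= br0l.
  exact/lcSl/memvf.
have H2 : (lower_central M 2 <= linfun i2 @^-1: lower_central (osum L M) 2)%VS.
  apply: lc_ind => x y _; rewrite -memv_preim lfunE.
  have -> : i2 [lie x, y] = [lie (i2 x), i2 y].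
    by rewrite /= /osum_bracket /= br0l.
  exact/lcSl/memvf.
move=> /(subvP H1) + /(subvP H2); rewrite -!memv_preim !lfunE => u2 v2.
have -> : (u, v) = i1 u + i2 v :> osum L M by congr pair; rewrite /= ?addr0 ?add0r.
by rewrite memvD.
Qed.

Lemma osum_spans (x : L) (y0 y1 : M) :
  spans (gens (d := 1) [:: x]) -> spans (gens (d := 2) [:: y0; y1]) ->
  spans (gens (d := 3) [:: (x, 0) : osum L M; (0, y0) : osum L M; (0, y1) : osum L M]).
Proof.
move=> /spans1P sx /spans2P sy; apply/spans3P => -[u v].
have [a ua] := sx u; have [b [c vbc]] := sy v; exists a, b, c.
have -> : (u, v) - (a *: ((x, 0) : osum L M) + b *: ((0, y0) : osum L M)
    + c *: ((0, y1) : osum L M)) = (u - a *: x, v - (b *: y0 + c *: y1)) :> osum L M.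
  by congr pair; rewrite /= !scaler0 ?addr0 ?add0r.
exact: osum_lc2.
Qed.

End OrthogonalSumSpans.

(** * Decomposable algebras of type 3 *)

Section DecomposableTypeThree.
Variables (K : closedFieldType) (cK : [pchar K] =i pred0).
Variable L : quadLie K.
Hypotheses (tL : lie_type L = 3%N) (L4 : lower_central L 4 = 0%VS).
Local Notation lc := (lower_central L).

Lemma central_generator (u : L) : (forall y, [lie u, y] = 0) -> 'B(u, u) != 0 ->
  exists y0 y1 y2 : L, [/\ spans (gens (d := 3) [:: y0; y1; y2]),
    forall y, [lie y0, y] = 0, 'B(y0, y0) = 1, 'B(y0, y1) = 0 & 'B(y0, y2) = 0].
Proof.
move=> uC uu; have [x sx] := spans_exist tL; have [c cu] := sx u.
have [a a2] := closed_root 'B(u, u) (isT : (0 < 2)%N).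
have a0 : a != 0 by apply: contraNneq uu => a0; rewrite -a2 a0 expr0n.
(* Otherwise [u] would lie in n^2, to which it is orthogonal, being central. *)
have c0 : \row_i c i != 0.
  apply: contraNneq uu => /rowP c0; move: cu.
  rewrite big1 => [|i _]; last by have := c0 i; rewrite !mxE => ->; rewrite scale0r.
  by rewrite subr0 => /(orth_central uC) ->.
have [P Pu [k k0 Pc]] := row_completion c0.
set g := fun i => \sum_j P i j *: x j; have sg : spans g by apply: spans_mx.
have g0 : g 0 = k *: \sum_i c i *: x i.
  rewrite /g scaler_sumr; apply: eq_bigr => i _; rewrite scalerA.
  by congr (_ *: _); have /rowP/(_ i) := Pc; rewrite !mxE.
have s1 : spans (gens (d := 3) [:: k *: u; g 1; g 2]).
  apply: spans_perturb sg _ => -[[|[|[|i]]] ilt] //=.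
  - have -> : g (Ordinal ilt) = g 0 by congr g; apply/val_inj.
    by rewrite g0 /gens /= -scalerBr memvZ.
  - by rewrite (_ : Ordinal ilt = 1) ?subrr ?mem0v //; apply/val_inj.
  - by rewrite (_ : Ordinal ilt = 2) ?subrr ?mem0v //; apply/val_inj.
pose y0 := a^-1 *: u.
have y00 : 'B(y0, y0) = 1 by rewrite /y0 fmZl fmZr -a2; field.
(* The other two generators are projected onto the orthogonal of the unit vector [y0]. *)
exists y0, (g 1 - 'B(y0, g 1) *: y0), (g 2 - 'B(y0, g 2) *: y0); split.
- apply: spans_sub s1 _ => i.
  exists (fun j => (nth [::] [:: [:: k * a; 0; 0]; [:: 'B(y0, g 1); 1; 0];
    [:: 'B(y0, g 2); 0; 1]] i)`_j).
  rewrite !big_ord_recl big_ord0 /gens /=.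
  rewrite [X in X \in _](_ : _ = 0) ?mem0v //; apply: fm_inj => y.
  by case: i => [[|[|[|i]]] ?] //=; rewrite /y0 !fmE; field.
- by move=> y; rewrite brZl uC scaler0.
- exact: y00.
- by rewrite fmDr fmNr fmZr y00 mulr1 subrr.
- by rewrite fmDr fmNr fmZr y00 mulr1 subrr.
Qed.

Lemma central_isometric_osum (u : L) : (forall y, [lie u, y] = 0) -> 'B(u, u) != 0 ->
  ~ lie_abelian L -> isometric L (osum (n11 K) (n23 K)).
Proof.
move=> uC uu nab; have [y0 [y1 [y2 [sy y0C G00 G01 G02]]]] := central_generator uC uu.
have y0L v : v \in lc 2 -> 'B(y0, v) = 0 by apply: orth_central.
have yC0 y : [lie y, y0] = 0 by rewrite brC y0C oppr0.
(* If [y1, y2] were isotropic it would be orthogonal to all words, hence 0, and the generators would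
   commute. *)
have b0 : 'B([lie y1, y2], [lie y1, y2]) != 0.
  apply/eqP => b0; apply: nab; apply: (commuting_abelian (nilpotent_lc L4) sy).
  have e0 : [lie y1, y2] = 0.
    apply: fm_eq0 => v; apply/eqP; rewrite fmC -mem_orthov1.
    rewrite (words_full (nilpotent_lc L4) sy (U := orthov (quad_form L) <[[lie y1, y2]]>))
      ?memvf //.
    move=> w k; rewrite mem_orthov1 fmC; apply/eqP.
    have e2 : [lie y1, y2] \in lc 2 by apply/lcSl/memvf.
    case: w => [|i [|j w]] /=; last first.
    - apply: (lc_perp L4 _ e2 (word_lc (gens (d := 3) [:: y0; y1; y2]) [:: i, j & w] k)).
      by rewrite /=; lia.
    - rewrite /gens; move: i k; apply: (pair_ind3 (P := fun i k =>
        'B([lie y1, y2], [lie [:: y0; y1; y2]`_i, [:: y0; y1; y2]`_k]) = 0)) => //=.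
      + by move=> i; rewrite brr fm0r.
      + by move=> i j E; rewrite (brC [:: y0; y1; y2]`_j) fmNr E oppr0.
      + by rewrite yC0 fm0r.
      + by rewrite y0C fm0r.
    - rewrite /gens; case: k => [[|[|[|k]]] ?] //=; rewrite fmC.
      + exact: y0L.
      + exact: fm_brl.
      + exact: fm_brr.
  apply: (pair_ind3 (P := fun i j =>
    [lie [:: y0; y1; y2]`_i, [:: y0; y1; y2]`_j] = 0)) => //=.
  - by move=> i; rewrite brr.
  - by move=> i j E; rewrite brC E oppr0.
have [m m2] := closed_root 'B([lie y1, y2], [lie y1, y2]) (isT : (0 < 2)%N).
have m0 : m != 0 by apply: contraNneq b0 => m0; rewrite -m2 m0 expr0n.
pose z1 := m^-1 *: y1.
have ee : 'B([lie z1, y2], [lie z1, y2]) = 1 by rewrite !brE !fmE -m2; field.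
have sz : spans (gens (d := 3) [:: y0; z1; y2]).
  apply: spans_sub sy _ => i; exists (fun j => (i == j)%:R * [:: 1; m; 1]`_j).
  rewrite !big_ord_recl big_ord0 /gens /=.
  rewrite [X in X \in _](_ : _ = 0) ?mem0v //; apply: fm_inj => y.
  by case: i => [[|[|[|i]]] ?] //=; rewrite /z1 !fmE; field.
have y0z1 : 'B(y0, z1) = 0 by rewrite fmZr G01 mulr0.
clearbody z1; set e := [lie z1, y2] in ee *.
have e2 : e \in lc 2 by apply/lcSl/memvf.
have lc3C p : p \in lc 3 -> forall y, [lie p, y] = 0.
  by move=> p3 y; apply/eqP; rewrite -memv0 -L4 lcSl.
pose p1 := [lie z1, e]; pose p2 := [lie y2, e].
have p13 : p1 \in lc 3 by apply: lcSr.
have p23 : p2 \in lc 3 by apply: lcSr.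
have p33 p q : p \in lc 3 -> q \in lc 3 -> 'B(p, q) = 0.
  by move=> p3 q3; apply: (lc_perp L4 _ p3 q3).
have p1z1 : 'B(p1, z1) = 0 by rewrite /p1 fmC fm_brl.
have p1y2 : 'B(p1, y2) = -1 by rewrite /p1 fm_adj -/e ee.
have p2z1 : 'B(p2, z1) = 1 by rewrite /p2 fm_adj brC -/e fmNr ee opprK.
have p2y2 : 'B(p2, y2) = 0 by rewrite /p2 fmC fm_brl.
(* Up to sign, [p2] and [p1] are dual to [z1] and [y2]; they are central and mutually orthogonal, so
   these corrections cancel the Gram matrix without changing brackets. *)
pose w1 := z1 - (2%:R^-1 * 'B(z1, z1)) *: p2.
pose w2 := y2 - 'B(z1, y2) *: p2 + (2%:R^-1 * 'B(y2, y2)) *: p1.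
have w1E y : [lie w1, y] = [lie z1, y].
  by rewrite /w1 brDl brNl (brZl _ p2) (lc3C p2) // scaler0 oppr0 addr0.
have w2E y : [lie w2, y] = [lie y2, y].
  by rewrite /w2 !brDl brNl !brZl (lc3C p1) // (lc3C p2) // !scaler0 oppr0 !addr0.
have eE : [lie w1, w2] = e by rewrite w1E brC w2E -brC.
have two := natr_neq0 cK 1.
have sw : spans (gens (d := 3) [:: y0; w1; w2]).
  have lc32 p : p \in lc 3 -> p \in lc 2 by move=> p3; apply: lc_mem p3 _.
  apply: spans3_perturb sz _ _ _; first by rewrite subrr mem0v.
    by rewrite addrC addKr memvN memvZ // lc32.
  by rewrite addrC /w2 -(addrA y2) addKr memvD ?memvN ?memvZ // lc32.
have [H00 H01 H11] := n23_gram K.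
have [D1 _ _ _] := n23_data K.
pose o0 : osum (n11 K) (n23 K) := (bas K 0 1, 0).
pose o1 : osum (n11 K) (n23 K) := (0, bas K 4 2).
pose o2 : osum (n11 K) (n23 K) := (0, bas K 4 1).
have fO (a b : n11 K) (c d : n23 K) :
  'B(((a, c) : osum (n11 K) (n23 K)), ((b, d) : osum (n11 K) (n23 K)))
    = 'B(a, b) + 'B(c, d) by [].
have bO (a b : n11 K) (c d : n23 K) :
  [lie ((a, c) : osum (n11 K) (n23 K)), ((b, d) : osum (n11 K) (n23 K))]
    = ([lie a, b], [lie c, d]) :> osum (n11 K) (n23 K) by [].
apply: (data3_isometric (x0 := y0) (x1 := w1) (x2 := w2) (y0 := o0) (y1 := o1)
  (y2 := o2) (t := 0) (E00 := 1) (E01 := 0) (E02 := 0) (E11 := 0) (E12 := 0)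
  (E22 := 0) L4) => //.
- apply: osum_lc0 (n23_lc4 K); apply/eqP; rewrite -subv0 -(n11_lc2 K); exact: lcS.
- exact: osum_spans (@n11_spans K) (@n23_spans K).
- by rewrite G00 /o0 fO n11_data fm0l addr0.
- by rewrite /w1 fmDr fmNr fmZr y0z1 y0L ?(lc_mem p23) // /o0 /o1 fO fm0r fm0l; ring.
- rewrite /w2 !fmDr fmNr !fmZr G02 !y0L ?(lc_mem p23) ?(lc_mem p13) //.
  by rewrite /o0 /o2 fO fm0r fm0l; ring.
- rewrite /o1 fO fm0l H00 /w1 !(fmDl, fmDr, fmNl, fmNr, fmZl, fmZr) (p33 p2 p2) //.
  by rewrite (fmC z1 p2) p2z1; field.
- rewrite /o1 /o2 fO fm0l H01 /w1 /w2 !(fmDl, fmDr, fmNl, fmNr, fmZl, fmZr).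
  by rewrite (p33 p2 p2) // (p33 p2 p1) // (fmC z1 p2) (fmC z1 p1) p2z1 p2y2 p1z1; ring.
- rewrite /o2 fO fm0l H11 /w2 !(fmDl, fmDr, fmNl, fmNr, fmZl, fmZr).
  rewrite (p33 p2 p2) // (p33 p2 p1) // (p33 p1 p2) // (p33 p1 p1) //
    (fmC y2 p2) (fmC y2 p1) p2y2 p1y2.
  by field.
- rewrite /data3 eE y0C yC0 !fm0r ?fm0l ee.
  by rewrite y0L.
- rewrite /data3 /o0 /o1 /o2 !bO !br0r ?br0l !fO !fm0r ?fm0l !add0r D1.
  by [].
Qed.

End DecomposableTypeThree.

(** * Orthogonal sums of a line and an algebra with two generators *)

Section OrthogonalSumWithLine.
Variables (K : closedFieldType) (T : quadLie K) (N : nat) (y0 y1 : T).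
Hypotheses (N2 : (2 <= N)%N) (TN : lower_central T N = 0%VS).
Hypotheses (sy : spans (gens (d := 2) [:: y0; y1])).
Hypothesis (iy : forall a b, a *: y0 + b *: y1 \in lower_central T 2 -> a = 0 /\ b = 0).
Hypothesis (y01 : [lie y0, y1] <> 0).
Local Notation S := (osum (n11 K) T).

Lemma osum_line_lc0 : lower_central S N = 0%VS.
Proof. by apply: osum_lc0 => //; apply/eqP; rewrite -subv0 -(n11_lc2 K) lcS. Qed.

Lemma osum_line_type : lie_type S = 3%N.
Proof.
apply: (type_indep (osum_spans (@n11_spans K) sy)) => c.
rewrite !big_ord_recl big_ord0 addr0 /gens /= => cS.
have /= [] := @osum_lc _ (n11 K) T 2 _ cS.
rewrite !scaler0 !addr0 !add0r (n11_lc2 K) memv0 => /eqP c0 /iy[c1 c2].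
case=> [[|[|[|i]]] ?] //; [|rewrite -[RHS]c1|rewrite -[RHS]c2];
  try by congr c; apply/val_inj.
have := congr1 (fun v : 'rV[K]_1 => crd v 1) c0.
rewrite /= crd0 crdZ crd_tvec //= mulr1 => <-; congr c; exact/val_inj.
Qed.

Lemma isometric_osum_line (L : quadLie K) : isometric L S ->
  [/\ lie_nilpotent L, ~ lie_abelian L, decomposable L, lie_type L = 3%N
    & lower_central L N = 0%VS].
Proof.
move=> isoL; have dim_lc i := isometric_dim_lc i isoL.
have tL : lie_type L = 3%N.
  by rewrite -osum_line_type /lie_type -[{:L}%VS]/(lower_central L 1) !dim_lc.
have LN : lower_central L N = 0%VS.
  by apply/eqP; rewrite -dimv_eq0 dim_lc osum_line_lc0 dimv0.
case: isoL => f [[f' fK f'K] fl ff]; split=> //.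
- exact: nilpotent_lc LN.
- move=> ab; apply: y01.
  have := ab (f' (0, y0)) (f' (0, y1)).
  move/(congr1 f); rewrite fl !f'K linear0 => /(congr1 snd) /=.
  by [].
(* The generator of the line is central and anisotropic, and so is its preimage in L. *)
- apply: (@nondegenerate_line _ _ (f' (bas K 0 1, 0))).
  + move=> y; apply: (can_inj fK); rewrite fl f'K linear0; congr pair => /=.
      by apply/rowP => i; rewrite !mxE big_nil.
    by rewrite br0l.
  + by rewrite -ff f'K /= /osum_form /= fm0l addr0 n11_data oner_eq0.
  + by move: tL; rewrite /lie_type; lia.
Qed.

End OrthogonalSumWithLine.

Unset Implicit Arguments.

Theorem theorem6p1 (K : closedFieldType) (charK : [pchar K] =i pred0) :
  [/\ (* the indecomposable algebras *)
      forall L : quadLie K, indecomposable L -> lie_nilpotent L ->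
        [\/ lie_type L = 1%N,
            lie_type L = 2%N /\ nilindex_le L 5
          | lie_type L = 3%N /\ nilindex_le L 3] ->
        isometric L (n11 K)
        \/ isometric L (n23 K)
        \/ isometric L (n25_1 K)
        \/ isometric L (n25_2 K)
        \/ isometric L (n32 K)
        \/ isometric L (n33_1 K)
        \/ isometric L (n33_2 K),
      (* type at most 2 *)
      forall L : quadLie K, lie_nilpotent L -> ~ lie_abelian L ->
        (lie_type L <= 2)%N -> indecomposable L,
      (* the decomposable algebras are orthogonal sums ... *)
      forall L : quadLie K, lie_nilpotent L -> ~ lie_abelian L ->
        decomposable L -> lie_type L = 3%N -> nilindex_le L 3 ->
        exists M : quadLie K,
          [\/ isometric M (n23 K), isometric M (n25_1 K)
            | isometric M (n25_2 K)]
          /\ isometric L (osum (n11 K) M)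
    & (* ... and conversely; only the sum with n23 has nilindex at most 3 *)
      forall L M : quadLie K,
        [\/ isometric M (n23 K), isometric M (n25_1 K)
          | isometric M (n25_2 K)] ->
        isometric L (osum (n11 K) M) ->
        [/\ lie_nilpotent L, ~ lie_abelian L, decomposable L, lie_type L = 3%N
          & isometric M (n23 K) -> nilindex_le L 3]].
Proof.
split.
- move=> L iL nL [tL|[tL nil]|[tL nil]].
  + by left; apply: type1_isometric.
  + have [?|?|?] := type2_classification charK iL tL (nilindex_le_lc0 (isT : (5 < 6)%N) nil);
      tauto.
  + have [?|?|?] := type3_classification charK iL tL (nilindex_le_lc0 (isT : (3 < 4)%N) nil);
      tauto.
- by move=> L nL nab tL /(decomposable_central nL)[/(_ tL)].
- move=> L nL nab /(decomposable_central nL)[_] + tL nil.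
  (* Nilindex at most 3 leaves [n23] as the complement of the central line. *)
  rewrite tL => /(_ isT)[u uC uu]; exists (n23 K); split.
    by constructor 1; apply: isometric_refl.
  by apply: central_isometric_osum uC uu nab => //; apply: nilindex_le_lc0 nil.
- move=> L M isoM isoL.
  have n23_y : [lie (bas K 4 2 : n23 K), (bas K 4 1 : n23 K)] <> 0.
    by move=> z0; have [+ _ _ _] := n23_data K; rewrite z0 fm0l => /esym/eqP; rewrite oner_eq0.
  (* Stated apart from [main] because the bound on the nilindex also needs n^4 = 0, which this case
     provides. *)
  have n23_case : isometric M (n23 K) ->
      [/\ lie_nilpotent L, ~ lie_abelian L, decomposable L, lie_type L = 3%N
        & lower_central L 4 = 0%VS].
    move=> iso; apply: (isometric_osum_line _ (n23_lc4 K) (@n23_spans K) (@n23_indep K)) => //.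
    exact: isometric_trans isoL (osum_isometric _ iso).
  have main : [/\ lie_nilpotent L, ~ lie_abelian L, decomposable L & lie_type L = 3%N].
    case: isoM => [/n23_case[] //|iso|iso].
    + have y01 : [lie (bas K 6 1 : n25_1 K), (bas K 6 2 : n25_1 K)] <> 0.
        move=> z0; have [_ + _ _] := n25_1_data K.
        by rewrite z0 br0r fm0l => /esym/eqP; rewrite oner_eq0.
      have [] := isometric_osum_line _ (n25_1_lc6 K) (@n25_1_spans K) (@n25_1_indep K) y01
        (isometric_trans isoL (osum_isometric _ iso)) => //.
    + have y01 : [lie (bas K 7 1 : n25_2 K), (bas K 7 2 : n25_2 K)] <> 0.
        move=> z0; have [_ + _ _] := n25_2_data K.
        by rewrite z0 br0r fm0l => /esym/eqP; rewrite oner_eq0.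
      have [] := isometric_osum_line _ (n25_2_lc6 K) (@n25_2_spans K) (@n25_2_indep K) y01
        (isometric_trans isoL (osum_isometric _ iso)) => //.
  case: main => nL nab dL tL; split=> // /n23_case[_ _ _ _ L4].
  (* L is nonzero because its type is 3. *)
  apply: lc0_nilindex_le L4 => L0; move: tL; rewrite /lie_type L0 dimv0; lia.
Qed.
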